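(* Let $R,B>0$, positive integers $k,T$, and $d=2d'$, and suppose $kT=\Omega((Rd/B)^2)$. For any given algorithm, consider the instance in $\mathbb{R}^d$ obtained as follows: in the first half of the rounds, use the noisy hypercube instance (Type A below) constructed on $d'$ of the coordinates, and in the second half of the rounds use the delayed-feedback instance (Type B below) constructed on the other $d'$ coordinates, with $\theta^*$ chosen accordingly on each block of coordinates. Then this instance achieves $$R(T)=\Omega\big(\min(Rd\sqrt{kT}+Bdk,\ BkT)\big).$$
   Context: Problem: in each round $t$ the learner observes feature vectors $x_t(i)\in\mathbb{R}^d$ ($i\in[N]$) and a family $S_t$ of $k$-subsets of $[N]$, chooses $I_t\in S_t$, and observes $r_t(i)={\theta^*}^\top x_t(i)+\eta_t(i)$ for $i\in I_t$. Regret $R(T)=\sum_{t}\big(\sum_{i\in I_t^*}{\theta^*}^\top x_t(i)-\sum_{i\in I_t}{\theta^*}^\top x_t(i)\big)$, $I_t^*\in\arg\max_{I\in S_t}\sum_{i\in I}{\theta^*}^\top x_t(i)$. Type A (in dimension $m$, over $T_A$ rounds): $N=k2^m$ arms; for each $s\in[k]$ the arms $(s-1)2^m+1,\dots,s2^m$ have feature vectors enumerating $\{-1,1\}^m$; $S_t$ consists of all $k$-subsets; noise i.i.d. $\mathcal{N}(0,R^2)$; $\theta^*\in\{-R/\sqrt{kT_A},R/\sqrt{kT_A}\}^m$ chosen adversarially for the algorithm. Type B (in dimension $m=2m'$, over $T_B$ rounds): $N=2k$ arms, $S_t$ all $k$-subsets of $[2k]$, zero noise; the rounds are divided into $\min(m',T_B)$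 groups and in group $j$, $x_t(i)=B\sqrt{m}e_{2j-1}$ for $i\le k$ and $x_t(i)=B\sqrt{m}e_{2j}$ for $i>k$ ($e_l$ standard basis); $\theta^*\in\{-1/\sqrt{m},1/\sqrt{m}\}^m$ chosen adversarially for the algorithm. *)

(* Defs.v *)
From HB Require Import structures.
From mathcomp Require Import all_boot all_order all_algebra.
From mathcomp Require Import all_classical all_reals all_analysis.
From mathcomp Require Import normal_distribution.
Set Implicit Arguments. Unset Strict Implicit. Unset Printing Implicit Defensive.
Import Order.TTheory GRing.Theory Num.Theory.
Local Open Scope ring_scope.

Fixpoint gauss_iter {R : realType} (s : R) (n : nat) :
    (n.-tuple R -> \bar R) -> \bar R :=
  match n return (n.-tuple R -> \bar R) -> \bar R with
  | 0 => fun F => F [tuple]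
  | n'.+1 => fun F =>
      (\int[normal_prob 0 s]_x gauss_iter s (fun v => F (cons_tuple x v)))%E
  end.

(* A (possibly randomized) algorithm is given as a behavioural strategy:     *)
(* pol t cs ys I is the probability of choosing I at round t, given the      *)
(* past choices cs and the past observations ys.  ys is the concatenation,   *)
(* round by round, of the vectors (r_u(i) if i \in I_u else 0)_{i in 'I_N}   *)
(* (listed along enum 'I_N), i.e. exactly the semi-bandit feedback.          *)

Definition inner {R : realType} (d : nat) (u v : 'I_d -> R) : R :=
  \sum_(l < d) u l * v l.

Definition set_value {R : realType} (N d : nat)
    (x : nat -> 'I_N -> 'I_d -> R) (theta : 'I_d -> R) (t : nat)
    (J : {set 'I_N}) : R :=
  \sum_(i in J) inner theta (x t i).

Definition round_gap {R : realType} (N d : nat)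
    (x : nat -> 'I_N -> 'I_d -> R) (S : nat -> pred {set 'I_N})
    (theta : 'I_d -> R) (t : nat) (I : {set 'I_N}) : \bar R :=
  ((\big[Order.max/-oo]_(J : {set 'I_N} | S t J) (set_value x theta t J)%:E)
     - (set_value x theta t I)%:E)%E.

Definition policy (R : realType) (N : nat) :=
  nat -> seq {set 'I_N} -> seq R -> {set 'I_N} -> R.

Definition valid_policy {R : realType} (N : nat) (S : nat -> pred {set 'I_N})
    (T : nat) (pol : policy R N) : Prop :=
  [/\ (forall t cs ys I, 0 <= pol t cs ys I),
      (forall t cs ys, \sum_(I : {set 'I_N}) pol t cs ys I = 1),
      (forall t cs ys I, (t < T)%N -> pol t cs ys I != 0 -> S t I) &
      (forall t cs (n : nat) I,
          measurable_fun [set: n.-tuple R] (fun v => pol t cs (tval v) I))].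

Definition observation {R : realType} (N d : nat)
    (x : nat -> 'I_N -> 'I_d -> R) (theta : 'I_d -> R) (t : nat)
    (I : {set 'I_N}) (eta : 'I_N -> R) : seq R :=
  [seq (if i \in I then inner theta (x t i) + eta i else 0) | i <- enum 'I_N].

Definition noise_expect {R : realType} (N : nat) (noisy : nat -> bool) (s : R)
    (t : nat) (F : ('I_N -> R) -> \bar R) : \bar R :=
  if noisy t then gauss_iter s (fun v : N.-tuple R => F (fun i => tnth v i))
  else F (fun _ => 0).

Fixpoint exp_regret_from {R : realType} (N d : nat)
    (x : nat -> 'I_N -> 'I_d -> R) (S : nat -> pred {set 'I_N})
    (noisy : nat -> bool) (s : R) (theta : 'I_d -> R) (pol : policy R N)
    (n t : nat) (cs : seq {set 'I_N}) (ys : seq R) : \bar R :=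
  match n with
  | 0 => 0%E
  | n'.+1 =>
    (\sum_(I : {set 'I_N})
       (pol t cs ys I)%:E *
       (round_gap x S theta t I +
        noise_expect noisy s t (fun eta =>
          exp_regret_from x S noisy s theta pol n' t.+1
            (rcons cs I) (ys ++ observation x theta t I eta))))%E
  end.

Definition expected_regret {R : realType} (N d : nat)
    (x : nat -> 'I_N -> 'I_d -> R) (S : nat -> pred {set 'I_N})
    (noisy : nat -> bool) (s : R) (theta : 'I_d -> R) (pol : policy R N)
    (T : nat) : \bar R :=
  exp_regret_from x S noisy s theta pol T 0 [::] [::].

(* The combined instance of Theorem 7.  Parameters: Rs = R, Bs = B, k, T,    *)
(* and m' with d' = 2 m', d = 2 d'.  Coordinates l < d' carry the Type A     *)
(* (noisy hypercube) instance, coordinates d' <= l < d the Type B instance.  *)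
(* Rounds t < T_A := T/2 are Type A rounds, rounds T_A <= t < T are Type B.  *)

Definition dA (m' : nat) : nat := (2 * m')%N.
Definition dtot (m' : nat) : nat := (2 * dA m')%N.
Definition narms (k m' : nat) : nat := (k * 2 ^ dA m')%N.
Definition TA (T : nat) : nat := T./2.
Definition TB (T : nat) : nat := (T - TA T)%N.

(* Type A: arm i (0-indexed) = (block s, offset o), o = i mod 2^d' encodes   *)
(* the vector of {-1,1}^{d'} whose l-th coordinate is -1 iff bit l of o is 1 *)
Definition featA {R : realType} (k m' : nat) (i : 'I_(narms k m'))
    (l : 'I_(dtot m')) : R :=
  if (val l < dA m')%N then
    (if odd ((i %% 2 ^ dA m') %/ 2 ^ l) then -1 else 1)
  else 0.

(* Type B (dimension m = d' = 2 m'): rounds split into min(m', T_B) groups;  *)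
(* round u = t - T_A (0-indexed) belongs to group j = u * G / T_B.  In group *)
(* j arms i < k have feature B sqrt(m) e_{2j-1}, arms k <= i < 2k have       *)
(* feature B sqrt(m) e_{2j} (0-indexed: coordinates d'+2j, d'+2j+1).  Arms   *)
(* i >= 2k do not exist in the Type B instance (zero feature, never feasible)*)
Definition featB {R : realType} (Bs : R) (k T m' : nat) (t : nat)
    (i : 'I_(narms k m')) (l : 'I_(dtot m')) : R :=
  let G := minn m' (TB T) in
  let j := ((t - TA T) * G %/ TB T)%N in
  if (val i < k)%N then (if l == (dA m' + 2 * j)%N :> nat
                     then Bs * Num.sqrt (dA m')%:R else 0)
  else if (val i < 2 * k)%N then (if l == (dA m' + 2 * j).+1 :> nat
                              then Bs * Num.sqrt (dA m')%:R else 0)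
  else 0.

Definition inst_feat {R : realType} (Bs : R) (k T m' : nat) (t : nat)
    (i : 'I_(narms k m')) (l : 'I_(dtot m')) : R :=
  if (t < TA T)%N then @featA R k m' i l else @featB R Bs k T m' t i l.

Definition inst_S (k T m' : nat) (t : nat) : pred {set 'I_(narms k m')} :=
  fun J => (#|J| == k) &&
           ((t < TA T)%N || (J \subset [set i : 'I_(narms k m') | (val i < 2 * k)%N])).

Definition inst_noisy (T : nat) (t : nat) : bool := (t < TA T)%N.

Definition inst_theta {R : realType} (Rs : R) (k T m' : nat)
    (sgn : 'I_(dtot m') -> bool) (l : 'I_(dtot m')) : R :=
  (if (val l < dA m')%N then Rs / Num.sqrt (k * TA T)%:R
   else 1 / Num.sqrt (dA m')%:R) * (if sgn l then 1 else -1).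

Arguments featA : clear implicits.
Arguments featB : clear implicits.
Arguments inst_feat : clear implicits.
Arguments inst_S : clear implicits.
Arguments inst_theta : clear implicits.
Arguments featA {R} k m' i l.
Arguments featB {R} Bs k T m' t i l.
Arguments inst_feat {R} Bs k T m' t i l.
Arguments inst_theta {R} Rs k T m' sgn l.

(* Main.v *)
Require Import Defs.
From HB Require Import structures.
From mathcomp Require Import all_boot all_order all_algebra.
From mathcomp Require Import all_classical all_reals all_analysis.
From mathcomp Require Import normal_distribution.
From mathcomp Require Import measurable_realfun ring lra zify.
Import Order.TTheory GRing.Theory Num.Theory.
Local Open Scope ring_scope.

Set Implicit Arguments.
Unset Strict Implicit.
Unset Printing Implicit Defensive.

(** Le Cam's two-point method, coordinate by coordinate. The regret dominates
    a sum of nonnegative costs: one for each Type A coordinate, and one for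
    each Type B group. If [V] and [V'] are the expected costs of one coordinate
    under two parameters differing only in its sign, then in every round where
    it is at stake the two costs add up to a constant.

    Type A: each feasible choice reveals exactly [k] Gaussians with means
    differing by [2 R / sqrt (k T_A)], so the Bhattacharyya coefficient of a
    round does not depend on the choice, and over [T_A] rounds the product is
    [exp (- 1 / 2)]. Cauchy-Schwarz propagates the lower bound on the product
    [(A + c + V) * (A' + c + V')] backwards through the rounds, where [A], [A']
    are the accumulated costs and [c] is a constant.

    Type B: before the first round of a group the observations carry no
    information about its sign, so [V + V'] is at least [2 B k].

    Averaging over all sign patterns, each paired with its flips, yields a
    pattern for which all these bounds hold in the mean. *)

(** * Gaussian expectations as Lebesgue integrals *)

Lemma lebesgue_measure_shift (R : realType) (m : R)
    (A : set (measurableTypeR R)) : measurable A ->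
  pushforward lebesgue_measure
    ((fun x => x + m) : measurableTypeR R -> measurableTypeR R) A
  = lebesgue_measure A.
Proof.
move=> mA; apply/esym/lebesgue_measure_unique => //=.
  exact: measurable_funD.
move=> _ _ [[a b]] _ <-; rewrite /pushforward /=.
rewrite (_ : preimage _ _ = `]a - m, b - m]%classic).
  rewrite !lebesgue_measure_itv /= !lte_fin ltrD2r !EFinN; case: ifP => // _.
  by congr (_%:E); ring.
by apply/seteqP; split => x /=; rewrite !in_itv /= ltrBlDr lerBrDr.
Qed.

(** The Radon-Nikodym derivative and [normal_pdf] have the same integral over every measurable set,
    hence agree almost everywhere. *)
Lemma integral_normal_prob (R : realType) (m s : R) (f : measurableTypeR R -> \bar R) :
  measurable_fun setT f -> (forall x, 0 <= f x)%E ->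
  (\int[normal_prob m s]_x f x
   = \int[lebesgue_measure]_x (f x * (normal_pdf m s x)%:E))%E.
Proof.
move=> mf f0; have dom := normal_prob_dominates m s.
rewrite -(Radon_Nikodym_SigmaFinite.change_of_variables dom) //.
have mrn := measurable_int _ (Radon_Nikodym_SigmaFinite.f_integrable dom).
have mpdf : measurable_fun [set: measurableTypeR R] (EFin \o normal_pdf m s).
  by apply/measurable_EFinP; exact: measurable_normal_pdf.
apply: ae_eq_integral => //; [exact: emeasurable_funM|exact: emeasurable_funM|].
apply: ae_eqe_mul2l; apply: integral_ae_eq => //.
  exact: Radon_Nikodym_SigmaFinite.f_integrable.
by move=> A _ mA; rewrite -Radon_Nikodym_SigmaFinite.f_integral.
Qed.

(** Translation invariance moves the shift from the integrand to the density. Two different means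
    can then be compared pointwise under one dominating measure. *)
Lemma integral_normal_shift (R : realType) (m s : R) (f : measurableTypeR R -> \bar R) :
  s != 0 -> measurable_fun setT f -> (forall x, 0 <= f x)%E ->
  (\int[normal_prob 0 s]_x f (x + m)%R
   = \int[lebesgue_measure]_x (f x * (normal_pdf m s x)%:E))%E.
Proof.
move=> s0 mf f0.
have msh : measurable_fun setT
    ((fun x => x + m) : measurableTypeR R -> measurableTypeR R).
  exact: measurable_funD.
have mpdf : measurable_fun [set: measurableTypeR R] (EFin \o normal_pdf m s).
  by apply/measurable_EFinP; exact: measurable_normal_pdf.
have mfs : measurable_fun setT ((fun x => f (x + m)) : measurableTypeR R -> \bar R).
  exact: (measurableT_comp mf msh).
rewrite (integral_normal_prob 0 s mfs); last by move=> x; exact: f0.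
pose h x := (f x * (normal_pdf m s x)%:E)%E.
transitivity (\int[lebesgue_measure]_x
    (h \o ((fun x => (x + m)%R) : measurableTypeR R -> measurableTypeR R)) x)%E.
  by apply: eq_integral => x _; rewrite /h /= !normal_pdfE // /normal_fun subr0 addrK.
rewrite -[in LHS](preimage_setT
  ((fun x => (x + m)%R) : measurableTypeR R -> measurableTypeR R)).
rewrite -(ge0_integral_pushforward msh) //; last 2 first.
- exact: emeasurable_funM.
- by move=> y _; rewrite mule_ge0 // lee_fin normal_pdf_ge0.
by apply: eq_measure_integral => A mA _; exact: lebesgue_measure_shift.
Qed.

(** * Bhattacharyya affinity of two Gaussians *)

(** Completing the square centres the product at the midpoint of the means; the exponential
    prefactor is the Bhattacharyya coefficient. *)
Lemma sqrt_normal_pdfM (R : realType) (m1 m2 s x : R) : s != 0 ->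
  Num.sqrt (normal_pdf m1 s x) * Num.sqrt (normal_pdf m2 s x)
  = expR (- (m1 - m2) ^+ 2 / (8 * s ^+ 2)) * normal_pdf ((m1 + m2) / 2) s x.
Proof.
move=> s0; rewrite -sqrtrM ?normal_pdf_ge0 // !normal_pdfE // /normal_fun.
set p := normal_peak s.
rewrite mulrACA -expRD -expr2.
have -> : - (x - m1) ^+ 2 / (s ^+ 2 *+ 2) + - (x - m2) ^+ 2 / (s ^+ 2 *+ 2)
   = 2 * (- (m1 - m2) ^+ 2 / (8 * s ^+ 2)
          + - (x - (m1 + m2) / 2) ^+ 2 / (s ^+ 2 *+ 2)).
  by field.
rewrite expRM_natl -exprMn sqrtr_sqr ger0_norm; last first.
  by rewrite mulr_ge0 ?expR_ge0 ?normal_peak_ge0.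
by rewrite expRD mulrCA.
Qed.

(* For finite [U] and [V] this says that [r ^+ 2 <= U * V] (when [0 <= r]);
   being linear in [(U, V)], it passes to sums and integrals. *)
Definition geo_ge {R : realType} (U V : \bar R) (r : R) : Prop :=
  forall a b : R, 0 <= a -> 0 <= b ->
    ((2 * a * b * r)%:E <= (a ^+ 2)%:E * U + (b ^+ 2)%:E * V)%E.

(* Cauchy-Schwarz against [sqrt (pdf m1 * pdf m2)], whose integral is the
   Bhattacharyya coefficient of the two Gaussians. *)
Lemma geo_ge_normal_shift (R : realType) (s m1 m2 r : R)
    (f g : measurableTypeR R -> \bar R) :
  s != 0 -> 0 <= r -> measurable_fun setT f -> measurable_fun setT g ->
  (forall x, 0 <= f x)%E -> (forall x, 0 <= g x)%E ->
  (forall x, geo_ge (f x) (g x) r) ->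
  geo_ge (\int[normal_prob 0 s]_x f (x + m1)%R)
         (\int[normal_prob 0 s]_x g (x + m2)%R)
         (expR (- (m1 - m2) ^+ 2 / (8 * s ^+ 2)) * r).
Proof.
move=> s0 r0 mf mg f0 g0 fg a b a0 b0.
rewrite !integral_normal_shift //.
have mpdf m : measurable_fun [set: measurableTypeR R] (EFin \o normal_pdf m s).
  by apply/measurable_EFinP; exact: measurable_normal_pdf.
have pdf0 m x : (0 <= (normal_pdf m s x)%:E)%E by rewrite lee_fin normal_pdf_ge0.
have mfp : measurable_fun setT (fun x => (f x * (normal_pdf m1 s x)%:E)%E).
  exact: emeasurable_funM mf (mpdf m1).
have mgp : measurable_fun setT (fun x => (g x * (normal_pdf m2 s x)%:E)%E).
  exact: emeasurable_funM mg (mpdf m2).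
have fp0 x : (0 <= f x * (normal_pdf m1 s x)%:E)%E by rewrite mule_ge0.
have gp0 x : (0 <= g x * (normal_pdf m2 s x)%:E)%E by rewrite mule_ge0.
have a20 : (0 <= (a ^+ 2)%:E)%E by rewrite lee_fin sqr_ge0.
have b20 : (0 <= (b ^+ 2)%:E)%E by rewrite lee_fin sqr_ge0.
rewrite -!ge0_integralZl // -ge0_integralD //; last 4 first.
- by move=> x _; rewrite mule_ge0.
- exact: measurable_funeM.
- by move=> x _; rewrite mule_ge0.
- exact: measurable_funeM.
set e := expR _.
have e0 : 0 <= e by exact: expR_ge0.
(* Spreading the constant over the midpoint density, of total mass 1, reduces the claim to a
   pointwise inequality. *)
have -> : (2 * a * b * (e * r))%:E = (\int[lebesgue_measure]_x
    ((2 * a * b * (e * r))%:E * (normal_pdf ((m1 + m2) / 2) s x)%:E))%E.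
  rewrite ge0_integralZl //; last by rewrite lee_fin !mulr_ge0.
    by rewrite integral_normal_pdf mule1.
  exact: mpdf.
refine (@ge0_le_integral _ _ R lebesgue_measure setT measurableT _ _ _ _ _ _).
- by move=> x _; rewrite mule_ge0 // lee_fin !mulr_ge0.
- exact: measurable_funeM (mpdf _).
- by apply: emeasurable_funD; exact: measurable_funeM.
move=> x _.
(* With these weights the squares give back the two densities, and the cross term is the product
   computed in [sqrt_normal_pdfM]. *)
have := fg x (a * Num.sqrt (normal_pdf m1 s x)) (b * Num.sqrt (normal_pdf m2 s x)).
rewrite !mulr_ge0 ?sqrtr_ge0 // => /(_ isT isT).
rewrite !exprMn !sqr_sqrtr ?normal_pdf_ge0 //.
rewrite [(a ^+ 2 * _)%:E]EFinM [(b ^+ 2 * _)%:E]EFinM.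
rewrite -muleA -[X in (_ <= _ + X)%E]muleA [(_%:E * f x)%E]muleC [(_%:E * g x)%E]muleC.
apply: le_trans; rewrite -EFinM lee_fin.
have := sqrt_normal_pdfM m1 m2 x s0; rewrite -/e => E.
rewrite le_eqVlt; apply/orP; left; apply/eqP.
transitivity (2 * a * b * r * (e * normal_pdf ((m1 + m2) / 2) s x)); first by ring.
by rewrite -E; ring.
Qed.

(** * Iterated Gaussian integrals *)

Lemma gauss_iter_ge0 (R : realType) (s : R) (n : nat) (F : n.-tuple R -> \bar R) :
  (forall v, 0 <= F v)%E -> (0 <= gauss_iter s F)%E.
Proof.
elim: n F => [|n IH] F F0 /=; first exact: F0.
by apply: integral_ge0 => y _; apply: IH => v; exact: F0.
Qed.

(** The parameter space [X] is quantified inside the induction: each step absorbs the first noise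
    coordinate into the parameter, and Tonelli then integrates it out. *)
Lemma measurable_gauss_iter (R : realType) (s : R) (n : nat) :
  forall (d : measure_display) (X : measurableType d)
    (F : X -> n.-tuple R -> \bar R),
  (forall x v, 0 <= F x v)%E ->
  measurable_fun [set: X * n.-tuple R] (fun p => F p.1 p.2) ->
  measurable_fun [set: X] (fun x => gauss_iter s (F x)).
Proof.
elim: n => [|n IH] d X F F0 mF /=.
  have mp : measurable_fun [set: X] (fun x : X => (x, [tuple] : 0.-tuple R)).
    by apply: measurable_fun_pair => //; exact: measurable_cst.
  exact: (measurableT_comp mF mp).
pose G (p : X * measurableTypeR R) :=
  gauss_iter s (fun v => F p.1 (cons_tuple p.2 v)).
have G0 p : (0 <= G p)%E by apply: gauss_iter_ge0 => v; exact: F0.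
have mG : measurable_fun setT G.
  apply: (IH _ _ (fun (p : X * measurableTypeR R) v => F p.1 (cons_tuple p.2 v))) => //.
  pose h (q : (X * measurableTypeR R) * n.-tuple R) :=
    (q.1.1, cons_tuple (q.1.2 : R) q.2).
  have mh : measurable_fun setT h.
    apply: measurable_fun_pair.
      exact: (measurableT_comp measurable_fst measurable_fst).
    apply: measurable_cons; last exact: measurable_snd.
    exact: (measurableT_comp measurable_snd measurable_fst).
  exact: (measurableT_comp mF mh).
exact (@measurable_fun_fubini_tonelli_F _ _ X (measurableTypeR R) R
  (normal_prob 0 s) G mG G0).
Qed.

Lemma measurable_gauss_iter_cons (R : realType) (s : R) (n : nat)
    (F : n.+1.-tuple R -> \bar R) :
  (forall v, 0 <= F v)%E -> measurable_fun setT F ->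
  measurable_fun [set: measurableTypeR R]
    (fun x => gauss_iter s (fun v => F (cons_tuple x v))).
Proof.
move=> F0 mF.
apply: (@measurable_gauss_iter R s n _ (measurableTypeR R)
  (fun x v => F (cons_tuple x v))) => //.
have mh : measurable_fun setT
    (fun q : measurableTypeR R * n.-tuple R => cons_tuple (q.1 : R) q.2).
  by apply: measurable_cons; [exact: measurable_fst|exact: measurable_snd].
exact: (measurableT_comp mF mh).
Qed.

Lemma measurable_cons_tuple (R : realType) (n : nat) (x : R) :
  measurable_fun setT (fun v : n.-tuple R => cons_tuple x v).
Proof. by apply: measurable_cons; [exact: measurable_cst|exact: measurable_id]. Qed.

Lemma gauss_iter_cst (R : realType) (s : R) (n : nat) (c : \bar R) :
  gauss_iter s (fun _ : n.-tuple R => c) = c.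
Proof.
elim: n => [|n IH] //=; rewrite IH integral_cst //.
by rewrite [X in (_ * X)%E]probability_setT mule1.
Qed.

Lemma gauss_iterD (R : realType) (s : R) (n : nat) (F G : n.-tuple R -> \bar R) :
  (forall v, 0 <= F v)%E -> (forall v, 0 <= G v)%E ->
  measurable_fun setT F -> measurable_fun setT G ->
  gauss_iter s (fun v => F v + G v)%E = (gauss_iter s F + gauss_iter s G)%E.
Proof.
elim: n F G => [|n IH] F G F0 G0 mF mG //=.
rewrite -ge0_integralD //.
- apply: eq_integral => x _; rewrite IH //.
  + exact: measurableT_comp mF (measurable_cons_tuple x).
  + exact: measurableT_comp mG (measurable_cons_tuple x).
- by move=> x _; exact: gauss_iter_ge0.
- exact: measurable_gauss_iter_cons.
- by move=> x _; exact: gauss_iter_ge0.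
- exact: measurable_gauss_iter_cons.
Qed.

Lemma le_gauss_iter (R : realType) (s : R) (n : nat) (F G : n.-tuple R -> \bar R) :
  (forall v, 0 <= F v)%E -> (forall v, F v <= G v)%E ->
  measurable_fun setT F -> measurable_fun setT G ->
  (gauss_iter s F <= gauss_iter s G)%E.
Proof.
elim: n F G => [|n IH] F G F0 FG mF mG /=; first exact: FG.
have G0 v : (0 <= G v)%E by exact: le_trans (FG v).
refine (@ge0_le_integral _ _ R (normal_prob 0 s) setT measurableT _ _ _ _ _ _).
- by move=> x _; apply: gauss_iter_ge0 => v; exact: F0.
- exact: measurable_gauss_iter_cons.
- exact: measurable_gauss_iter_cons.
- move=> x _; apply: IH => [v|v||]; [exact: F0|exact: FG| |].
  + exact: measurableT_comp mF (measurable_cons_tuple x).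
  + exact: measurableT_comp mG (measurable_cons_tuple x).
Qed.

(** * Functions of the observation history *)

(** Measurability is asked for each history length separately, the form in which [valid_policy]
    provides it. *)
Definition seq_measurable {R : realType} (W : seq R -> \bar R) : Prop :=
  forall n, measurable_fun [set: n.-tuple R] (fun v => W (tval v)).

(** With [b] the membership in the chosen set and [m] the mean rewards, this is the feedback vector
    of a noisy round. *)
Definition shifted {R : realType} {n : nat} (b : 'I_n -> bool) (m : 'I_n -> R)
    (v : n.-tuple R) : n.-tuple R :=
  [tuple if b i then m i + tnth v i else 0 | i < n].

Lemma measurable_shifted (R : realType) (n : nat) (b : 'I_n -> bool) (m : 'I_n -> R) :
  measurable_fun setT (shifted b m).
Proof.
apply/measurable_fun_tnthP => i.
rewrite (_ : _ \o _ = (fun v => if b i then m i + tnth v i else 0)); last first.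
  by apply/funext => v /=; rewrite tnth_mktuple.
case: (b i); last exact: measurable_cst.
by apply: measurable_funD; [exact: measurable_cst|exact: measurable_tnth].
Qed.

Lemma shifted_cons (R : realType) (n : nat) (b : 'I_n.+1 -> bool)
    (m : 'I_n.+1 -> R) (x : R) (v : n.-tuple R) :
  tval (shifted b m (cons_tuple x v)) =
  (if b ord0 then m ord0 + x else 0)
    :: tval (shifted (b \o lift ord0) (m \o lift ord0) v).
Proof.
rewrite /shifted /= enum_ordSl /= -map_comp; congr cons.
by apply: eq_map => i /=; rewrite tnthS.
Qed.

(** Affinities of independent coordinates multiply. The induction peels off one arm at a time; an
    unchosen arm shows 0 under both parameters and contributes the factor 1. *)
Lemma geo_ge_gauss_iter (R : realType) (s r : R) (n : nat) (b : 'I_n -> bool)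
    (m1 m2 : 'I_n -> R) (W1 W2 : seq R -> \bar R) :
  s != 0 -> 0 <= r -> seq_measurable W1 -> seq_measurable W2 ->
  (forall ys, 0 <= W1 ys)%E -> (forall ys, 0 <= W2 ys)%E ->
  (forall ys, geo_ge (W1 ys) (W2 ys) r) ->
  geo_ge (gauss_iter s (fun v => W1 (shifted b m1 v)))
         (gauss_iter s (fun v => W2 (shifted b m2 v)))
         ((\prod_(i < n | b i) expR (- (m1 i - m2 i) ^+ 2 / (8 * s ^+ 2))) * r).
Proof.
move=> s0; elim: n b m1 m2 W1 W2 r => [|n IH] b m1 m2 W1 W2 r r0 mW1 mW2 W10 W20 W12.
  rewrite big_ord0 mul1r /=.
  have nilE m : tval (shifted b m [tuple]) = [::] by apply: size0nil; rewrite size_tuple.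
  by rewrite !nilE; exact: W12.
pose f (W : seq R -> \bar R) (m : 'I_n.+1 -> R) (y : measurableTypeR R) :=
  gauss_iter s (fun v => W (y :: shifted (b \o lift ord0) (m \o lift ord0) v)).
have f0 W m y : (forall ys, 0 <= W ys)%E -> (0 <= f W m y)%E.
  by move=> W0; exact: gauss_iter_ge0.
have mf W m : (forall ys, 0 <= W ys)%E -> seq_measurable W ->
    measurable_fun setT (f W m).
  move=> W0 mW.
  apply: (@measurable_gauss_iter R s n _ (measurableTypeR R)
    (fun y v => W (y :: shifted (b \o lift ord0) (m \o lift ord0) v))) => //.
  have mh : measurable_fun setT (fun q : measurableTypeR R * n.-tuple R =>
      cons_tuple (q.1 : R) (shifted (b \o lift ord0) (m \o lift ord0) q.2)).
    apply: measurable_cons; first exact: measurable_fst.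
    exact: measurableT_comp (measurable_shifted _ _) measurable_snd.
  exact: (measurableT_comp (mW n.+1) mh).
have mWc (W : seq R -> \bar R) y :
    seq_measurable W -> seq_measurable (fun ys => W (y :: ys)).
  by move=> mW k; exact: (measurableT_comp (mW k.+1) (measurable_cons_tuple y)).
pose e i := expR (- (m1 i - m2 i) ^+ 2 / (8 * s ^+ 2)).
pose r' := (\prod_(i < n | b (lift ord0 i)) e (lift ord0 i)) * r.
have r'0 : 0 <= r' by rewrite mulr_ge0 // prodr_ge0 // => i _; exact: expR_ge0.
have f12 y : geo_ge (f W1 m1 y) (f W2 m2 y) r'.
  apply: (IH _ (m1 \o lift ord0) (m2 \o lift ord0)
    (fun ys => W1 (y :: ys)) (fun ys => W2 (y :: ys))) => //; exact: mWc.
(* The inner integral depends on the first noise variable only through the first observation, so the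
   one-dimensional bound applies to [f]. *)
have E (W : seq R -> \bar R) m : gauss_iter s (fun v => W (shifted b m v))
    = (\int[normal_prob 0 s]_x f W m (if b ord0 then x + m ord0 else 0)%R)%E.
  apply: eq_integral => x _; rewrite /f; congr gauss_iter; apply/funext => v.
  by rewrite shifted_cons [m ord0 + x]addrC.
rewrite !{}E big_mkcond big_ord_recl -big_mkcond /= -mulrA.
have -> : \prod_(i < n | b (lift ord0 i)) e (lift ord0 i) * r = r' by [].
case: ifP => b0.
  exact (geo_ge_normal_shift (m1 ord0) (m2 ord0) s0 r'0
    (mf _ m1 W10 mW1) (mf _ m2 W20 mW2)
    (fun x => f0 _ _ x W10) (fun x => f0 _ _ x W20) f12).
have cstE (c : \bar R) : (\int[normal_prob 0 s]_(x in setT) c = c)%E.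
  exact: (@gauss_iter_cst R s 1 c).
rewrite mul1r !cstE.
exact (f12 0).
Qed.

Lemma measurable_cat_tuple (R : realType) (d : measure_display)
    (X : measurableType d) (n m : nat) (f : X -> n.-tuple R) (g : X -> m.-tuple R) :
  measurable_fun setT f -> measurable_fun setT g ->
  measurable_fun setT (fun x => cat_tuple (f x) (g x)).
Proof.
move=> mf mg; apply/measurable_fun_tnthP => i.
rewrite -(fintype.splitK i); case: (fintype.split i) => j /=.
  rewrite (_ : _ \o _ = (@tnth _ R ^~ j) \o f).
    exact: measurableT_comp (measurable_tnth j) mf.
  by apply/funext => x /=; rewrite tnth_lshift.
rewrite (_ : _ \o _ = (@tnth _ R ^~ j) \o g).
  exact: measurableT_comp (measurable_tnth j) mg.
by apply/funext => x /=; rewrite tnth_rshift.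
Qed.

(** * Conditional expectation over the feedback of one round *)

Definition after_round {R : realType} {N d : nat} (x : nat -> 'I_N -> 'I_d -> R)
    (noisy : nat -> bool) (s : R) (theta : 'I_d -> R) (t : nat) (I : {set 'I_N})
    (W : seq R -> \bar R) (ys : seq R) : \bar R :=
  noise_expect noisy s t (fun eta => W (ys ++ observation x theta t I eta)).

Lemma after_round_noisy (R : realType) (N d : nat) (x : nat -> 'I_N -> 'I_d -> R)
    (noisy : nat -> bool) (s : R) (theta : 'I_d -> R) (t : nat) (I : {set 'I_N})
    (W : seq R -> \bar R) (ys : seq R) : noisy t ->
  after_round x noisy s theta t I W ys = gauss_iter s (fun v : N.-tuple R =>
    W (ys ++ shifted (fun i => i \in I) (fun i => inner theta (x t i)) v)).
Proof. by rewrite /after_round /noise_expect => ->. Qed.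

Lemma after_round_ge0 (R : realType) (N d : nat) (x : nat -> 'I_N -> 'I_d -> R)
    (noisy : nat -> bool) (s : R) (theta : 'I_d -> R) (t : nat) (I : {set 'I_N})
    (W : seq R -> \bar R) (ys : seq R) :
  (forall ys, 0 <= W ys)%E -> (0 <= after_round x noisy s theta t I W ys)%E.
Proof.
move=> W0; rewrite /after_round /noise_expect; case: ifP => _ //.
exact: gauss_iter_ge0.
Qed.

Lemma seq_measurable_cat (R : realType) (W : seq R -> \bar R) (ys : seq R) :
  seq_measurable W -> seq_measurable (fun zs => W (ys ++ zs)).
Proof.
move=> mW n.
have mc : measurable_fun setT (fun v : n.-tuple R => cat_tuple (in_tuple ys) v).
  by apply: measurable_cat_tuple; [exact: measurable_cst|exact: measurable_id].
exact: (measurableT_comp (mW _) mc).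
Qed.

Lemma measurable_after_noise (R : realType) (N : nat) (b : 'I_N -> bool)
    (m : 'I_N -> R) (W : seq R -> \bar R) (ys : seq R) :
  seq_measurable W ->
  measurable_fun setT (fun v : N.-tuple R => W (ys ++ shifted b m v)).
Proof.
move=> mW.
exact (measurableT_comp (seq_measurable_cat ys mW (n := N)) (measurable_shifted b m)).
Qed.

Lemma seq_measurable_after_round (R : realType) (N d : nat)
    (x : nat -> 'I_N -> 'I_d -> R) (noisy : nat -> bool) (s : R)
    (theta : 'I_d -> R) (t : nat) (I : {set 'I_N}) (W : seq R -> \bar R) :
  (forall ys, 0 <= W ys)%E -> seq_measurable W ->
  seq_measurable (after_round x noisy s theta t I W).
Proof.
move=> W0 mW n; case nt: (noisy t); last first.
  pose o := observation x theta t I (fun=> 0).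
  have mc : measurable_fun setT (fun v : n.-tuple R => cat_tuple v (in_tuple o)).
    by apply: measurable_cat_tuple; [exact: measurable_id|exact: measurable_cst].
  rewrite (_ : (fun _ => _) = (fun v => W (tval v ++ o))).
    exact: (measurableT_comp (mW _) mc).
  by apply/funext => v; rewrite /after_round /noise_expect nt.
pose sh := shifted (fun i => i \in I) (fun i => inner theta (x t i)).
rewrite (_ : (fun _ => _) =
    (fun v : n.-tuple R => gauss_iter s (fun w => W (v ++ sh w)))).
  apply: (@measurable_gauss_iter R s N _ (n.-tuple R) (fun v w => W (v ++ sh w))) => //.
  have mc : measurable_fun setT
      (fun q : n.-tuple R * N.-tuple R => cat_tuple q.1 (sh q.2)).
    apply: measurable_cat_tuple; first exact: measurable_fst.
    exact: (measurableT_comp (measurable_shifted _ _) measurable_snd).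
  exact: (measurableT_comp (mW _) mc).
by apply/funext => v; exact: after_round_noisy.
Qed.

Lemma after_roundD (R : realType) (N d : nat) (x : nat -> 'I_N -> 'I_d -> R)
    (noisy : nat -> bool) (s : R) (theta : 'I_d -> R) (t : nat) (I : {set 'I_N})
    (W1 W2 : seq R -> \bar R) (ys : seq R) :
  (forall ys, 0 <= W1 ys)%E -> (forall ys, 0 <= W2 ys)%E ->
  seq_measurable W1 -> seq_measurable W2 ->
  after_round x noisy s theta t I (fun zs => W1 zs + W2 zs)%E ys =
  (after_round x noisy s theta t I W1 ys + after_round x noisy s theta t I W2 ys)%E.
Proof.
move=> W10 W20 mW1 mW2; case nt: (noisy t).
  by rewrite !after_round_noisy // gauss_iterD //; exact: measurable_after_noise.
by rewrite /after_round /noise_expect nt.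
Qed.

Lemma after_round_cst (R : realType) (N d : nat) (x : nat -> 'I_N -> 'I_d -> R)
    (noisy : nat -> bool) (s : R) (theta : 'I_d -> R) (t : nat) (I : {set 'I_N})
    (c : \bar R) (ys : seq R) :
  after_round x noisy s theta t I (fun=> c) ys = c.
Proof.
by rewrite /after_round /noise_expect; case: ifP => // _; exact: gauss_iter_cst.
Qed.

Lemma le_after_round (R : realType) (N d : nat) (x : nat -> 'I_N -> 'I_d -> R)
    (noisy : nat -> bool) (s : R) (theta : 'I_d -> R) (t : nat) (I : {set 'I_N})
    (W1 W2 : seq R -> \bar R) (ys : seq R) :
  (forall ys, 0 <= W1 ys)%E -> (forall ys, W1 ys <= W2 ys)%E ->
  seq_measurable W1 -> seq_measurable W2 ->
  (after_round x noisy s theta t I W1 ys <= after_round x noisy s theta t I W2 ys)%E.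
Proof.
move=> W10 W12 mW1 mW2; case nt: (noisy t).
  by rewrite !after_round_noisy // le_gauss_iter //; exact: measurable_after_noise.
by rewrite /after_round /noise_expect nt.
Qed.

(** Feedback depends on the parameter only through the means of the chosen arms, so parameters
    agreeing on these are indistinguishable in this round. *)
Lemma eq_after_round (R : realType) (N d : nat) (x : nat -> 'I_N -> 'I_d -> R)
    (noisy : nat -> bool) (s : R) (theta1 theta2 : 'I_d -> R) (t : nat)
    (I : {set 'I_N}) (W : seq R -> \bar R) (ys : seq R) :
  (forall i, i \in I -> inner theta1 (x t i) = inner theta2 (x t i)) ->
  after_round x noisy s theta1 t I W ys = after_round x noisy s theta2 t I W ys.
Proof.
move=> E; rewrite /after_round; congr noise_expect; apply/funext => eta.
by congr (W (_ ++ _)); apply: eq_map => i; case: ifP => // /E ->.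
Qed.

(** * Expected cumulative cost of a policy *)

(** The recursion of [exp_regret_from] with an arbitrary per-round cost [z], so that the regret can
    be split into costs of single coordinates. *)
Fixpoint policy_cost {R : realType} {N d : nat} (x : nat -> 'I_N -> 'I_d -> R)
    (noisy : nat -> bool) (s : R) (theta : 'I_d -> R) (pol : policy R N)
    (z : nat -> {set 'I_N} -> \bar R) (n t : nat) (cs : seq {set 'I_N})
    (ys : seq R) : \bar R :=
  match n with
  | 0 => 0%E
  | n'.+1 => (\sum_(I : {set 'I_N}) (pol t cs ys I)%:E *
      (z t I + after_round x noisy s theta t I
         (policy_cost x noisy s theta pol z n' t.+1 (rcons cs I)) ys))%E
  end.

Lemma exp_regret_fromE (R : realType) (N d : nat) (x : nat -> 'I_N -> 'I_d -> R)
    (S : nat -> pred {set 'I_N}) (noisy : nat -> bool) (s : R)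
    (theta : 'I_d -> R) (pol : policy R N) (n t : nat) cs ys :
  exp_regret_from x S noisy s theta pol n t cs ys =
  policy_cost x noisy s theta pol (round_gap x S theta) n t cs ys.
Proof.
elim: n t cs ys => [//|n IH] t cs ys /=; apply: eq_bigr => I _.
congr (_ * (_ + _))%E; rewrite /after_round; congr noise_expect.
by apply/funext => eta; exact: IH.
Qed.

(** Infeasible choices have probability zero, so the costs need to agree only on feasible ones. *)
Lemma eq_policy_cost (R : realType) (N d : nat) (x : nat -> 'I_N -> 'I_d -> R)
    (S : nat -> pred {set 'I_N}) (noisy : nat -> bool) (s : R)
    (theta : 'I_d -> R) (pol : policy R N) (T : nat)
    (z1 z2 : nat -> {set 'I_N} -> \bar R) (n t : nat) cs ys :
  valid_policy S T pol -> (t + n <= T)%N ->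
  (forall t I, (t < T)%N -> S t I -> z1 t I = z2 t I) ->
  policy_cost x noisy s theta pol z1 n t cs ys =
  policy_cost x noisy s theta pol z2 n t cs ys.
Proof.
move=> [_ _ polS _] + z12; elim: n t cs ys => [//|n IH] t cs ys tn /=.
apply: eq_bigr => I _; have [->|pI] := eqVneq (pol t cs ys I) 0.
  by rewrite !mul0e.
have tT : (t < T)%N by rewrite (leq_trans _ tn) // addnS ltnS leq_addr.
rewrite (z12 _ _ tT (polS _ _ _ _ tT pI)); congr (_ * (_ + _))%E.
rewrite /after_round; congr noise_expect; apply/funext => eta.
by apply: IH; rewrite addSnnS.
Qed.

Lemma policy_cost_ge0 (R : realType) (N d : nat) (x : nat -> 'I_N -> 'I_d -> R)
    (S : nat -> pred {set 'I_N}) (noisy : nat -> bool) (s : R)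
    (theta : 'I_d -> R) (pol : policy R N) (T : nat)
    (z : nat -> {set 'I_N} -> \bar R) (n t : nat) cs ys :
  valid_policy S T pol -> (forall t I, 0 <= z t I)%E ->
  (0 <= policy_cost x noisy s theta pol z n t cs ys)%E.
Proof.
move=> [pol0 _ _ _] z0; elim: n t cs ys => [//|n IH] t cs ys /=.
apply: sume_ge0 => I _; rewrite mule_ge0 ?lee_fin // adde_ge0 //.
exact: after_round_ge0.
Qed.

Lemma seq_measurable_policy_cost (R : realType) (N d : nat)
    (x : nat -> 'I_N -> 'I_d -> R) (S : nat -> pred {set 'I_N})
    (noisy : nat -> bool) (s : R) (theta : 'I_d -> R) (pol : policy R N)
    (T : nat) (z : nat -> {set 'I_N} -> \bar R) (n t : nat) cs :
  valid_policy S T pol -> (forall t I, 0 <= z t I)%E ->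
  seq_measurable (policy_cost x noisy s theta pol z n t cs).
Proof.
move=> vp z0; elim: n t cs => [|n IH] t cs m /=; first exact: measurable_cst.
apply: emeasurable_sum => I; apply: emeasurable_funM.
  by case: vp => _ _ _ mp; apply/measurable_EFinP; exact: mp.
apply: emeasurable_funD; first exact: measurable_cst.
apply: (seq_measurable_after_round x noisy s theta t I _ (IH _ _)) => zs.
exact: policy_cost_ge0 vp z0.
Qed.

Lemma le_policy_cost (R : realType) (N d : nat) (x : nat -> 'I_N -> 'I_d -> R)
    (S : nat -> pred {set 'I_N}) (noisy : nat -> bool) (s : R)
    (theta : 'I_d -> R) (pol : policy R N) (T : nat)
    (z1 z2 : nat -> {set 'I_N} -> \bar R) (n t : nat) cs ys :
  valid_policy S T pol -> (t + n <= T)%N ->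
  (forall t I, 0 <= z1 t I)%E -> (forall t I, 0 <= z2 t I)%E ->
  (forall t I, (t < T)%N -> S t I -> (z1 t I <= z2 t I)%E) ->
  (policy_cost x noisy s theta pol z1 n t cs ys <=
   policy_cost x noisy s theta pol z2 n t cs ys)%E.
Proof.
move=> vp + z10 z20 z12; elim: n t cs ys => [//|n IH] t cs ys tn /=.
have [pol0 _ polS _] := vp.
apply: lee_sum => I _; have [->|pI] := eqVneq (pol t cs ys I) 0.
  by rewrite !mul0e.
have tT : (t < T)%N by rewrite (leq_trans _ tn) // addnS ltnS leq_addr.
apply: lee_wpmul2l; first by rewrite lee_fin.
apply: leeD; first exact: z12 (polS _ _ _ _ tT pI).
apply: le_after_round => [zs|zs||].
- exact: policy_cost_ge0 vp z10.
- by apply: IH; rewrite addSnnS.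
- exact: seq_measurable_policy_cost vp z10.
- exact: seq_measurable_policy_cost vp z20.
Qed.

Lemma policy_costD (R : realType) (N d : nat) (x : nat -> 'I_N -> 'I_d -> R)
    (S : nat -> pred {set 'I_N}) (noisy : nat -> bool) (s : R)
    (theta : 'I_d -> R) (pol : policy R N) (T : nat)
    (z1 z2 : nat -> {set 'I_N} -> \bar R) (n t : nat) cs ys :
  valid_policy S T pol ->
  (forall t I, 0 <= z1 t I)%E -> (forall t I, 0 <= z2 t I)%E ->
  policy_cost x noisy s theta pol (fun t I => z1 t I + z2 t I)%E n t cs ys =
  (policy_cost x noisy s theta pol z1 n t cs ys +
   policy_cost x noisy s theta pol z2 n t cs ys)%E.
Proof.
move=> vp z10 z20; elim: n t cs ys => [|n IH] t cs ys /=; first by rewrite adde0.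
have [pol0 _ _ _] := vp.
have c0 z u ds zs : (forall t I, 0 <= z t I)%E ->
    (0 <= policy_cost x noisy s theta pol z n u ds zs)%E.
  by move=> z0; exact: policy_cost_ge0 vp z0.
rewrite -big_split /=; apply: eq_bigr => I _.
rewrite (_ : policy_cost _ _ _ _ _ _ n t.+1 (rcons cs I) = fun zs =>
    (policy_cost x noisy s theta pol z1 n t.+1 (rcons cs I) zs +
     policy_cost x noisy s theta pol z2 n t.+1 (rcons cs I) zs)%E); last first.
  by apply/funext => zs; exact: IH.
rewrite after_roundD; last 4 first.
- by move=> zs; exact: c0.
- by move=> zs; exact: c0.
- exact: seq_measurable_policy_cost vp z10.
- exact: seq_measurable_policy_cost vp z20.
rewrite -ge0_muleDr; last 2 first.
- by rewrite adde_ge0 // after_round_ge0 // => zs; exact: c0.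
- by rewrite adde_ge0 // after_round_ge0 // => zs; exact: c0.
by rewrite addeACA.
Qed.

Lemma policy_cost0 (R : realType) (N d : nat) (x : nat -> 'I_N -> 'I_d -> R)
    (noisy : nat -> bool) (s : R) (theta : 'I_d -> R) (pol : policy R N)
    (n t : nat) cs ys :
  policy_cost x noisy s theta pol (fun _ _ => 0%E) n t cs ys = 0%E.
Proof.
elim: n t cs ys => [//|n IH] t cs ys /=.
apply: big1 => I _; rewrite (_ : policy_cost _ _ _ _ _ _ _ _ _ = fun=> 0%E).
  by rewrite after_round_cst adde0 mule0.
by apply/funext => zs; exact: IH.
Qed.

Lemma policy_cost_sum (R : realType) (N d : nat) (x : nat -> 'I_N -> 'I_d -> R)
    (S : nat -> pred {set 'I_N}) (noisy : nat -> bool) (s : R)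
    (theta : 'I_d -> R) (pol : policy R N) (T : nat) (J : Type) (r : seq J)
    (z : J -> nat -> {set 'I_N} -> \bar R) (n t : nat) cs ys :
  valid_policy S T pol -> (forall j t I, 0 <= z j t I)%E ->
  policy_cost x noisy s theta pol (fun t I => \sum_(j <- r) z j t I)%E n t cs ys =
  (\sum_(j <- r) policy_cost x noisy s theta pol (z j) n t cs ys)%E.
Proof.
move=> vp z0; elim: r => [|j r IH].
  rewrite big_nil -[RHS](policy_cost0 x noisy s theta pol n t cs ys).
  by congr policy_cost; do 2 (apply/funext => ?); rewrite big_nil.
rewrite big_cons -IH -(policy_costD x noisy s theta n t cs ys vp (z0 j)).
  by congr policy_cost; do 2 (apply/funext => ?); rewrite big_cons.
by move=> u I; exact: sume_ge0.
Qed.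

(** * Two-point lower bounds *)

Lemma geo_ge_le (R : realType) (U U' V V' : \bar R) (r : R) :
  (U <= U')%E -> (V <= V')%E -> geo_ge U V r -> geo_ge U' V' r.
Proof.
move=> UU' VV' H a b a0 b0; apply: le_trans (H a b a0 b0) _.
by apply: leeD; apply: lee_wpmul2l; rewrite // lee_fin sqr_ge0.
Qed.

Lemma geo_ge_sqrt (R : realType) (u v w : R) :
  0 <= u -> 0 <= v -> w <= u * v -> geo_ge u%:E v%:E (Num.sqrt w).
Proof.
move=> u0 v0 wuv a b a0 b0; rewrite -!EFinM -EFinD lee_fin.
have h : Num.sqrt w <= Num.sqrt u * Num.sqrt v.
  by rewrite -sqrtrM // ler_wsqrtr.
apply: (@le_trans _ _ (2 * a * b * (Num.sqrt u * Num.sqrt v))).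
  by apply: ler_wpM2l => //; rewrite !mulr_ge0.
have := sqr_ge0 (a * Num.sqrt u - b * Num.sqrt v).
rewrite sqrrB !exprMn !sqr_sqrtr //; lra.
Qed.

(** Given a common history the policy uses the same weights [p] under both parameters, and an
    inequality linear in the pair survives averaging. *)
Lemma geo_ge_sum (R : realType) (J : finType) (p : J -> R) (U V : J -> \bar R)
    (r : R) :
  (forall j, 0 <= p j) -> \sum_j p j = 1 ->
  (forall j, 0 <= U j)%E -> (forall j, 0 <= V j)%E ->
  (forall j, p j != 0 -> geo_ge (U j) (V j) r) ->
  geo_ge (\sum_j (p j)%:E * U j)%E (\sum_j (p j)%:E * V j)%E r.
Proof.
move=> p0 p1 U0 V0 UV a b a0 b0.
rewrite !ge0_sume_distrr; last 2 first.
- by move=> j _; rewrite mule_ge0 ?lee_fin.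
- by move=> j _; rewrite mule_ge0 ?lee_fin.
rewrite -big_split /=.
rewrite -[leLHS]mule1 (_ : 1%E = \sum_j (p j)%:E)%E; last by rewrite sumEFin p1.
rewrite ge0_sume_distrr; last first.
  by move=> j _; rewrite lee_fin.
apply: lee_sum => j _; have [->|pj] := eqVneq (p j) 0.
  by rewrite !mul0e !mule0 adde0.
rewrite muleC muleCA [X in (_ <= _ + X)%E]muleCA -ge0_muleDr.
- by apply: lee_wpmul2l; [rewrite lee_fin|exact (UV j pj a b a0 b0)].
- by rewrite mule_ge0 ?lee_fin ?sqr_ge0.
- by rewrite mule_ge0 ?lee_fin ?sqr_ge0.
Qed.

Lemma sum_policyD (R : realType) (J : finType) (p : J -> R) (U : J -> \bar R) (c : R) :
  (forall j, 0 <= p j) -> \sum_j p j = 1 -> 0 <= c -> (forall j, 0 <= U j)%E ->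
  (c%:E + \sum_j (p j)%:E * U j = \sum_j (p j)%:E * (c%:E + U j))%E.
Proof.
move=> p0 p1 c0 U0.
under [in RHS]eq_bigr => j _ do rewrite ge0_muleDr ?lee_fin //.
rewrite big_split /= -ge0_sume_distrl ?sumEFin ?p1 ?mul1e //.
by move=> j _; rewrite lee_fin.
Qed.

(* Hellinger version of Le Cam's two-point bound, by induction on the number
   of remaining rounds; [A1] and [A2] are the costs accumulated so far. The
   product form [geo_ge] is what makes the induction go through without a
   measure on histories. *)
Lemma geo_ge_policy_cost (R : realType) (N d : nat) (x : nat -> 'I_N -> 'I_d -> R)
    (S : nat -> pred {set 'I_N}) (noisy : nat -> bool) (s : R)
    (theta1 theta2 : 'I_d -> R) (pol : policy R N) (T0 T : nat)
    (z1 z2 : nat -> {set 'I_N} -> R) (kap rho c K : R) (n t : nat) cs ys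
    (A1 A2 : R) :
  valid_policy S T pol -> s != 0 -> 0 <= rho -> 0 <= c -> 0 <= K ->
  (forall t I, 0 <= z1 t I) -> (forall t I, 0 <= z2 t I) ->
  (forall t, (t < T0)%N -> noisy t) ->
  (forall t I, (t < T0)%N -> S t I -> kap <= z1 t I + z2 t I) ->
  (forall t I, (t < T0)%N -> S t I ->
    \prod_(i in I) expR (- (inner theta1 (x t i) - inner theta2 (x t i)) ^+ 2
                         / (8 * s ^+ 2)) = rho) ->
  (T0 <= t + n)%N -> (t + n <= T)%N -> 0 <= A1 -> 0 <= A2 ->
  K <= A1 + A2 + kap * (T0 - t)%:R ->
  geo_ge
    ((A1 + c)%:E + policy_cost x noisy s theta1 pol (fun t I => (z1 t I)%:E) n t cs ys)
    ((A2 + c)%:E + policy_cost x noisy s theta2 pol (fun t I => (z2 t I)%:E) n t cs ys)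
    (Num.sqrt (c * (K + c)) * rho ^+ (T0 - t)).
Proof.
move=> vp s0 rho0 c0 K0 z10 z20 ns z12 aff.
have Ez10 u I : (0 <= (z1 u I)%:E)%E by rewrite lee_fin.
have Ez20 u I : (0 <= (z2 u I)%:E)%E by rewrite lee_fin.
have c1 theta m u ds zs := policy_cost_ge0 x noisy s theta m u ds zs vp Ez10.
have c2 theta m u ds zs := policy_cost_ge0 x noisy s theta m u ds zs vp Ez20.
elim: n t cs ys A1 A2 => [|n IH] t cs ys A1 A2 T0t tT A10 A20 KA.
(* Once [t] reaches [T0], future costs are dropped: [K <= A1 + A2] gives
   [c * (K + c) <= (A1 + c) * (A2 + c)]. *)
all: have [T0t'|tT0] := leqP T0 t.
2: by move: T0t; rewrite addn0 leqNgt tT0.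
1,2: move: KA; rewrite (eqP (_ : T0 - t == 0)%N) ?subn_eq0 //
  mulr0 addr0 expr0 mulr1 => KA.
1,2: apply: (@geo_ge_le _ (A1 + c)%:E _ (A2 + c)%:E); rewrite ?leeDl ?c1 ?c2 //.
1,2: apply: geo_ge_sqrt; [lra|lra|nra].
have [pol0 pol1 polS _] := vp.
have tltT : (t < T)%N by rewrite (leq_trans _ tT) // addnS ltnS leq_addr.
rewrite /= !sum_policyD ?addr_ge0 //; last 2 first.
- by move=> I; rewrite adde_ge0 // after_round_ge0 // => zs; exact: c2.
- by move=> I; rewrite adde_ge0 // after_round_ge0 // => zs; exact: c1.
apply: geo_ge_sum => // [I|I|I pI].
- by rewrite adde_ge0 ?lee_fin ?addr_ge0 // adde_ge0 // after_round_ge0.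
- by rewrite adde_ge0 ?lee_fin ?addr_ge0 // adde_ge0 // after_round_ge0.
have SI := polS _ _ _ _ tltT pI.
pose W theta (z : nat -> {set 'I_N} -> R) (A : R) zs :=
  (A%:E + policy_cost x noisy s theta pol (fun t I => (z t I)%:E)
            n t.+1 (rcons cs I) (ys ++ zs))%E.
(* The cost of this round joins the accumulated one, and the constant goes under the expectation,
   leaving a single Gaussian integral. *)
have step theta (z : nat -> {set 'I_N} -> R) (A : R) :
  0 <= A -> (forall t I, 0 <= z t I) ->
  ((A + c)%:E + ((z t I)%:E + after_round x noisy s theta t I
     (policy_cost x noisy s theta pol (fun t I => (z t I)%:E) n t.+1 (rcons cs I)) ys)
  = gauss_iter s (fun v : N.-tuple R => W theta z (A + z t I + c)%R
       (shifted (fun i => i \in I) (fun i => inner theta (x t i)) v)))%E.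
  move=> A0 z0; have Ez0 u J : (0 <= (z u J)%:E)%E by rewrite lee_fin.
  rewrite -[RHS](@after_round_noisy _ _ _ x noisy s theta t I (fun zs =>
    (A + z t I + c)%:E + policy_cost x noisy s theta pol (fun t I => (z t I)%:E)
        n t.+1 (rcons cs I) zs)%E ys (ns _ tT0)).
  rewrite after_roundD ?after_round_cst.
  - by rewrite addeA -EFinD addrAC.
  - by move=> zs; rewrite lee_fin !addr_ge0.
  - by move=> zs; exact: policy_cost_ge0 vp Ez0.
  - by move=> m; exact: measurable_cst.
  - exact: seq_measurable_policy_cost vp Ez0.
rewrite !step //.
(* One factor [rho] pays for the current round; the others come from the induction hypothesis. *)
have -> : Num.sqrt (c * (K + c)) * rho ^+ (T0 - t)
    = rho * (Num.sqrt (c * (K + c)) * rho ^+ (T0 - t.+1)).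
  by rewrite mulrCA -exprS subnSK.
rewrite -{1}(aff t I tT0 SI).
have mW theta (z : nat -> {set 'I_N} -> R) (A : R) : (forall t I, 0 <= z t I) ->
    seq_measurable (W theta z A).
  move=> z0 m; apply: emeasurable_funD; first exact: measurable_cst.
  apply: seq_measurable_cat; apply: seq_measurable_policy_cost vp _ => u J.
  by rewrite lee_fin.
refine (@geo_ge_gauss_iter R s _ N (fun i => i \in I) _ _
  (W theta1 z1 (A1 + z1 t I + c)) (W theta2 z2 (A2 + z2 t I + c)) s0 _ _ _ _ _ _).
- by rewrite mulr_ge0 ?sqrtr_ge0 ?exprn_ge0.
- exact: mW.
- exact: mW.
- by move=> zs; rewrite adde_ge0 ?lee_fin ?addr_ge0 ?c1.
- by move=> zs; rewrite adde_ge0 ?lee_fin ?addr_ge0 ?c2.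
move=> zs; refine (IH t.+1 (rcons cs I) (ys ++ zs) (A1 + z1 t I) (A2 + z2 t I) _ _ _ _ _).
all: rewrite ?addSnnS ?addr_ge0 //.
(* The accumulated costs grow by at least [kap] while one stake round fewer remains, so the bound by
   [K] persists. *)
have := z12 t I tT0 SI; move: KA; rewrite -(subnSK tT0) -[in X in X -> _]natr1; lra.
Qed.

(* The choice [c := K / 8] in [geo_ge_policy_cost]. *)
Lemma two_point_policy_cost (R : realType) (N d : nat) (x : nat -> 'I_N -> 'I_d -> R)
    (S : nat -> pred {set 'I_N}) (noisy : nat -> bool) (s : R)
    (theta1 theta2 : 'I_d -> R) (pol : policy R N) (T0 T : nat)
    (z1 z2 : nat -> {set 'I_N} -> R) (kap rho : R) :
  valid_policy S T pol -> s != 0 -> 0 <= rho -> 0 <= kap ->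
  (forall t I, 0 <= z1 t I) -> (forall t I, 0 <= z2 t I) ->
  (forall t, (t < T0)%N -> noisy t) ->
  (forall t I, (t < T0)%N -> S t I -> kap <= z1 t I + z2 t I) ->
  (forall t I, (t < T0)%N -> S t I ->
    \prod_(i in I) expR (- (inner theta1 (x t i) - inner theta2 (x t i)) ^+ 2
                         / (8 * s ^+ 2)) = rho) ->
  (T0 <= T)%N -> 2^-1 <= rho ^+ T0 ->
  ((kap * T0%:R / 8)%:E <=
   policy_cost x noisy s theta1 pol (fun t I => (z1 t I)%:E) T 0 [::] [::] +
   policy_cost x noisy s theta2 pol (fun t I => (z2 t I)%:E) T 0 [::] [::])%E.
Proof.
move=> vp s0 rho0 kap0 z10 z20 ns z12 aff T0T rhoT.
pose K := kap * T0%:R; pose c := K / 8.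
have K0 : 0 <= K by rewrite mulr_ge0.
have c0 : 0 <= c by rewrite divr_ge0.
have := @geo_ge_policy_cost R N d x S noisy s theta1 theta2 pol T0 T z1 z2 kap rho
  c K T 0 [::] [::] 0 0 vp s0 rho0 c0 K0 z10 z20 ns z12 aff.
rewrite add0n subn0 !add0r => /(_ T0T (leqnn T) (lexx _) (lexx _) (lexx _)).
move=> /(_ 1 1 ler01 ler01); rewrite !mulr1 expr1n !mul1e.
set V1 := policy_cost _ _ _ _ _ _ _ _ _ _; set V2 := policy_cost _ _ _ _ _ _ _ _ _ _.
(* The choice of [c] makes this a perfect square. With [rho ^+ T0 >= 1 / 2] the bound is at least
   [3 / 8 * K], and removing [c + c = K / 4] leaves [K / 8]. *)
have -> : c * (K + c) = (3 / 8 * K) ^+ 2 by rewrite /c; field.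
rewrite sqrtr_sqr ger0_norm; last by rewrite mulr_ge0.
rewrite addeACA -EFinD => H.
rewrite -(@leeD2lE _ (c + c)%:E) // -EFinD.
apply: le_trans H; rewrite lee_fin.
have : K * 2^-1 <= K * rho ^+ T0 by rewrite ler_wpM2l.
by rewrite -/K /c; lra.
Qed.

(** Up to round [t0] the two histories have the same law, so the choice made there also has the same
    law, and its two costs can be added under one average. *)
Lemma uninformed_policy_cost (R : realType) (N d : nat) (x : nat -> 'I_N -> 'I_d -> R)
    (S : nat -> pred {set 'I_N}) (noisy : nat -> bool) (s : R)
    (theta1 theta2 : 'I_d -> R) (pol : policy R N) (T t0 : nat)
    (z1 z2 : nat -> {set 'I_N} -> \bar R) (kap : R) (n t : nat) cs ys :
  valid_policy S T pol -> 0 <= kap ->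
  (forall t I, 0 <= z1 t I)%E -> (forall t I, 0 <= z2 t I)%E ->
  (forall t I i, (t < t0)%N -> S t I -> i \in I ->
    inner theta1 (x t i) = inner theta2 (x t i)) ->
  (forall I, S t0 I -> (kap%:E <= z1 t0 I + z2 t0 I)%E) ->
  (t <= t0 < t + n)%N -> (t + n <= T)%N ->
  (kap%:E <= policy_cost x noisy s theta1 pol z1 n t cs ys +
             policy_cost x noisy s theta2 pol z2 n t cs ys)%E.
Proof.
move=> vp kap0 z10 z20 same z12.
have c1 theta m u ds zs := policy_cost_ge0 x noisy s theta m u ds zs vp z10.
have c2 theta m u ds zs := policy_cost_ge0 x noisy s theta m u ds zs vp z20.
elim: n t cs ys => [|n IH] t cs ys.
  by rewrite addn0 => /andP[tt0 t0t]; move: (leq_ltn_trans tt0 t0t); rewrite ltnn.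
move=> /andP[tt0 t0n] tT /=; have [pol0 pol1 polS _] := vp.
have tltT : (t < T)%N by rewrite (leq_trans _ tT) // addnS ltnS leq_addr.
rewrite -[leLHS]mul1e -(pol1 t cs ys) -sumEFin ge0_sume_distrl; last first.
  by move=> I _; rewrite lee_fin.
rewrite -big_split /=; apply: lee_sum => I _.
have [->|pI] := eqVneq (pol t cs ys I) 0; first by rewrite !mul0e adde0.
have SI := polS _ _ _ _ tltT pI.
have a1 : (0 <= after_round x noisy s theta1 t I
    (policy_cost x noisy s theta1 pol z1 n t.+1 (rcons cs I)) ys)%E.
  by apply: after_round_ge0 => zs; exact: c1.
have a2 : (0 <= after_round x noisy s theta2 t I
    (policy_cost x noisy s theta2 pol z2 n t.+1 (rcons cs I)) ys)%E.
  by apply: after_round_ge0 => zs; exact: c2.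
rewrite -ge0_muleDr ?adde_ge0 //; apply: lee_wpmul2l; first by rewrite lee_fin.
(* At [t0] the immediate costs suffice and the future is dropped; before [t0] the immediate costs
   are dropped instead. *)
rewrite addeACA; move: tt0; rewrite leq_eqVlt => /orP[/eqP tE|tt0].
  apply: le_trans (leeDl _ (adde_ge0 a1 a2)); rewrite tE; apply: z12.
  by rewrite -tE.
apply: le_trans (leeDr _ (adde_ge0 (z10 _ _) (z20 _ _))).
rewrite -(eq_after_round noisy s _ ys (theta1 := theta1)); last first.
  by move=> i iI; exact: same iI.
rewrite -after_roundD.
- rewrite -[leLHS](@after_round_cst R N d x noisy s theta1 t I kap%:E ys).
  apply: le_after_round => [zs|zs||].
  + by rewrite lee_fin.
  + by apply: IH; rewrite ?tt0 addSnnS.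
  + by move=> m; exact: measurable_cst.
  + move=> m; apply: emeasurable_funD.
      exact: (seq_measurable_policy_cost x noisy s theta1 n t.+1 (rcons cs I) vp z10).
    exact: (seq_measurable_policy_cost x noisy s theta2 n t.+1 (rcons cs I) vp z20).
- by move=> zs; exact: c1.
- by move=> zs; exact: c2.
- exact: seq_measurable_policy_cost vp z10.
- exact: seq_measurable_policy_cost vp z20.
Qed.

(** * Averaging over sign patterns *)

Definition flip {n : nat} (u : 'I_n) (sigma : {ffun 'I_n -> bool}) :
    {ffun 'I_n -> bool} :=
  [ffun i => sigma i (+) (i == u)].

Lemma flipK (n : nat) (u : 'I_n) : involutive (flip u).
Proof. by move=> sigma; apply/ffunP => i; rewrite !ffunE addbK. Qed.

(** Flipping one sign permutes the patterns, so summing over all of them pairs each with its flip,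
    separately for every [j]. A pattern maximizing the total then beats the average. *)
Lemma exists_sum_ge_flip (R : realType) (n : nat) (J : finType) (u : J -> 'I_n)
    (f : J -> {ffun 'I_n -> bool} -> \bar R) (b : J -> R) :
  (forall j sigma, 0 <= f j sigma)%E ->
  (forall j sigma, (b j)%:E <= f j sigma + f j (flip (u j) sigma))%E ->
  exists sigma, (((\sum_j b j) / 2)%:E <= \sum_j f j sigma)%E.
Proof.
move=> f0 fb; pose g sigma := (\sum_j f j sigma)%E.
pose s0 : {ffun 'I_n -> bool} := [ffun=> true].
have [s _ smax] := @arg_maxP _ _ _ s0 predT g isT.
have gs sigma : (g sigma <= g s)%E by exact: smax.
exists s; rewrite -/(g s).
have sum_ge : (\sum_(sigma : {ffun 'I_n -> bool}) (\sum_j b j)%:E <=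
    \sum_(sigma : {ffun 'I_n -> bool}) (g s + g s))%E.
  apply: (@le_trans _ _ (\sum_(sigma : {ffun 'I_n -> bool}) (g sigma + g sigma))%E).
    rewrite big_split /= /g [X in (_ <= X + _)%E]exchange_big.
    rewrite [X in (_ <= _ + X)%E]exchange_big -big_split /=.
    under eq_bigr => sigma _ do rewrite -sumEFin.
    rewrite exchange_big; apply: lee_sum => j _.
    rewrite [X in (_ <= _ + X)%E](reindex_inj (inv_inj (flipK (u j)))) -big_split /=.
    by apply: lee_sum => sigma _; exact: fb.
  by apply: lee_sum => sigma _; apply: leeD; exact: gs.
have gs0 : (0 <= g s)%E by exact: sume_ge0.
case: (g s) sum_ge gs0 => [r|_ _|] //; last by rewrite leey.
under [X in (_ <= X)%E]eq_bigr => sigma _ do rewrite -EFinD.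
rewrite !sumEFin !sumr_const !lee_fin => H _.
suff : \sum_j b j <= r + r by lra.
have c0 : (0 < #|{ffun 'I_n -> bool}|)%N by apply/card_gt0P; exists s.
by move: H; rewrite lerMn2r; case: (#|_|) c0.
Qed.

Lemma round_gap_ge (R : realType) (N d : nat) (x : nat -> 'I_N -> 'I_d -> R)
    (S : nat -> pred {set 'I_N}) (theta : 'I_d -> R) (t : nat) (I J : {set 'I_N}) :
  S t J -> ((set_value x theta t J - set_value x theta t I)%:E
            <= round_gap x S theta t I)%E.
Proof.
move=> SJ; rewrite EFinB; apply: leeD => //.
exact: (@le_bigmax_cond _ _ _ _ _ (S t) (fun J => (set_value x theta t J)%:E)).
Qed.

(** * Arithmetic of arm indices and of groups *)

(** Each hypercube block thus contains an arm with any prescribed sign vector; the offset is built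
    from its lowest bit upwards. *)
Lemma bits_exist (D : nat) (b : nat -> bool) :
  exists2 w, (w < 2 ^ D)%N & forall l, (l < D)%N -> odd (w %/ 2 ^ l) = b l.
Proof.
elim: D b => [|D IH] b; first by exists 0%N.
have [w wD wb] := IH (b \o S); exists (b 0%N + w.*2)%N.
  by rewrite expnS mul2n; move: wD; case: (b 0%N); lia.
case=> [_|l lD].
  by rewrite expn0 divn1 oddD odd_double addbF oddb.
rewrite expnS divnMA (_ : (b 0%N + w.*2) %/ 2 = w)%N ?wb //.
by rewrite divn2 half_bit_double.
Qed.

(** The least [u] with [j * TB <= u * G] works: by minimality [u * G] exceeds [j * TB] by less than
    [G <= TB], so no group is skipped. *)
Lemma first_round (G TB j : nat) : (j < G)%N -> (G <= TB)%N ->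
  exists u, [/\ (u < TB)%N, (u * G %/ TB = j)%N &
                forall u', (u' < u)%N -> (u' * G %/ TB < j)%N].
Proof.
move=> jG GT; have T0 : (0 < TB)%N by exact: leq_trans (leq_trans _ jG) GT.
have G0 : (0 < G)%N by exact: leq_trans jG.
have ex : exists u, (j * TB <= u * G)%N.
  by exists TB; rewrite mulnC leq_mul2l ltnW // orbT.
pose u := ex_minn ex; exists u; rewrite /u; case: ex_minnP => v jv vmin.
have vlt u' : (u' < v)%N -> (u' * G %/ TB < j)%N.
  move=> u'v; rewrite ltn_divLR // ltnNge.
  by apply: contraL u'v => /vmin; rewrite -leqNgt.
have vj : (v * G %/ TB = j)%N.
  apply/eqP; rewrite eqn_leq leq_divRL // jv andbT -ltnS ltn_divLR //.
  case: v {vmin} jv vlt => [|v] jv vlt; first by rewrite mul0n muln_gt0 T0.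
  have := vlt v (ltnSn v); rewrite ltn_divLR // => h.
  by rewrite !mulSn; lia.
split => //.
have : (v * G < j.+1 * TB)%N by rewrite -ltn_divLR // vj.
move=> h; rewrite -(ltn_pmul2r G0) (leq_trans h) // mulnC leq_mul2l jG orbT //.
Qed.

(** * Sign patterns and coordinate costs on the combined instance *)

Definition pm {R : realType} (b : bool) : R := if b then 1 else -1.

Lemma pm_sqr (R : realType) (b : bool) : pm b * pm b = 1 :> R.
Proof. by case: b; rewrite /= ?mulr1 ?mulrNN ?mulr1. Qed.

Lemma even_coord_subproof (n : nat) (l : 'I_n) : (l - odd l < n)%N.
Proof. exact: leq_ltn_trans (leq_subr _ _) (ltn_ord l). Qed.

(** Type B pairs start at even indices because [dA m'] is even, so this is the first coordinate of
    the pair of [l]. *)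
Definition even_coord {n : nat} (l : 'I_n) : 'I_n := Ordinal (even_coord_subproof l).

(* On the Type B block the two coordinates of a group carry opposite signs,
   both read off [sigma] at the even one. *)
Definition signs {m' : nat} (sigma : {ffun 'I_(dtot m') -> bool})
    (l : 'I_(dtot m')) : bool :=
  if (l < dA m')%N then sigma l else sigma (even_coord l) (+) odd l.

Definition groupB (T m' t : nat) : nat :=
  ((t - TA T) * minn m' (TB T) %/ TB T)%N.

Lemma coordB_subproof (m' g : nat) : (g < m')%N -> (dA m' + 2 * g < dtot m')%N.
Proof. rewrite /dtot /dA; lia. Qed.

Definition coordB {m' g : nat} (gm : (g < m')%N) : 'I_(dtot m') :=
  Ordinal (coordB_subproof gm).

Lemma coordBS_subproof (m' g : nat) : (g < m')%N -> ((dA m' + 2 * g).+1 < dtot m')%N.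
Proof. rewrite /dtot /dA; lia. Qed.

Lemma signs_coordB (m' g : nat) (gm : (g < m')%N) (sigma : {ffun 'I_(dtot m') -> bool}) :
  signs sigma (coordB gm) = sigma (coordB gm).
Proof.
rewrite /signs /= ltnNge leq_addr /= (_ : odd _ = false) ?addbF; last by rewrite /dA; lia.
by congr (sigma _); apply: val_inj => /=; rewrite (_ : odd _ = false) ?subn0 // /dA; lia.
Qed.

Lemma signs_coordBS (m' g : nat) (gm : (g < m')%N) (sigma : {ffun 'I_(dtot m') -> bool}) :
  signs sigma (Ordinal (coordBS_subproof gm)) = ~~ sigma (coordB gm).
Proof.
have E : odd (dA m' + 2 * g) = false by rewrite /dA; lia.
rewrite /signs /= ltnNge (leq_trans (leq_addr _ _) (leqnSn _)) /= E addbT.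
by congr (~~ sigma _); apply: val_inj => /=; rewrite E /= subn1.
Qed.

Lemma groupB_lt (T m' t : nat) : (0 < m')%N -> (TA T <= t)%N -> (t < T)%N ->
  (groupB T m' t < minn m' (TB T))%N.
Proof.
move=> m0 At tT; have B0 : (0 < TB T)%N by rewrite subn_gt0 (leq_ltn_trans At).
rewrite /groupB ltn_divLR // mulnC ltn_pmul2l ?ltn_sub2rE //.
by rewrite leq_min m0 B0.
Qed.

(** The share of coordinate [l] in the gap: a chosen arm whose sign at [l] is wrong loses twice the
    parameter size. *)
Definition costA {R : realType} (Rs : R) (k T m' : nat)
    (sigma : {ffun 'I_(dtot m') -> bool}) (l : 'I_(dtot m')) (t : nat)
    (I : {set 'I_(narms k m')}) : R :=
  if (t < TA T)%N && (l < dA m')%N then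
    \sum_(i in I) Rs / Num.sqrt (k * TA T)%:R * (1 - pm (sigma l) * featA k m' i l)
  else 0.

(** The whole gap of a Type B round is charged to the first coordinate of its group; each arm taken
    from the worse half loses [2 * Bs]. *)
Definition costB {R : realType} (Bs : R) (k T m' : nat)
    (sigma : {ffun 'I_(dtot m') -> bool}) (l : 'I_(dtot m')) (t : nat)
    (I : {set 'I_(narms k m')}) : R :=
  if (TA T <= t)%N && (l == dA m' + 2 * groupB T m' t :> nat)%N then
    \sum_(i in I) Bs * (1 - pm (sigma l) * pm (i < k)%N)
  else 0.

Lemma pm_le1 (R : realType) (b c : bool) : 0 <= 1 - pm b * pm c :> R.
Proof. by case: b; case: c; rewrite /pm; lra. Qed.

Lemma featA_pm (R : realType) (k m' : nat) (i : 'I_(narms k m')) (l : 'I_(dtot m')) :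
  (l < dA m')%N ->
  featA k m' i l = pm (~~ odd ((i %% 2 ^ dA m') %/ 2 ^ l)) :> R.
Proof. by rewrite /featA => ->; case: (odd _). Qed.

Lemma costA_ge0 (R : realType) (Rs : R) (k T m' : nat) sigma l t I :
  0 <= Rs -> 0 <= @costA R Rs k T m' sigma l t I.
Proof.
move=> R0; rewrite /costA; case: ifP => // /andP[_ lD].
apply: sumr_ge0 => i _; rewrite mulr_ge0 ?divr_ge0 ?sqrtr_ge0 //.
by rewrite featA_pm // pm_le1.
Qed.

Lemma costB_ge0 (R : realType) (Bs : R) (k T m' : nat) sigma l t I :
  0 <= Bs -> 0 <= @costB R Bs k T m' sigma l t I.
Proof.
move=> B0; rewrite /costB; case: ifP => // _.
by apply: sumr_ge0 => i _; rewrite mulr_ge0 // pm_le1.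
Qed.

Lemma inner_featA (R : realType) (Rs : R) (k T m' : nat)
    (sigma : {ffun 'I_(dtot m') -> bool}) (i : 'I_(narms k m')) :
  inner (inst_theta Rs k T m' (signs sigma)) (featA k m' i) =
  \sum_(l < dtot m' | (l < dA m')%N)
     Rs / Num.sqrt (k * TA T)%:R * (pm (sigma l) * featA k m' i l).
Proof.
rewrite /inner [RHS]big_mkcond; apply: eq_bigr => l _.
rewrite /inst_theta /signs /pm; case: ifP => lD; first by rewrite mulrA.
by rewrite /featA lD mulr0.
Qed.

(** The square roots in feature and parameter cancel, and the opposite signs within a pair merge
    both halves into [pm (i < k)]. *)
Lemma inner_featB (R : realType) (Rs Bs : R) (k T m' t : nat)
    (sigma : {ffun 'I_(dtot m') -> bool}) (i : 'I_(narms k m'))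
    (gm : (groupB T m' t < m')%N) : (i < 2 * k)%N ->
  inner (inst_theta Rs k T m' (signs sigma)) (featB Bs k T m' t i) =
  Bs * (pm (sigma (coordB gm)) * pm (i < k)%N).
Proof.
move=> i2k; have m0 : (0 < m')%N by exact: leq_trans gm.
have s0 : Num.sqrt (dA m')%:R != 0 :> R.
  by rewrite gt_eqF // sqrtr_gt0 ltr0n /dA; lia.
rewrite /inner /featB /= -/(groupB T m' t) i2k; case ik: (i < k)%N.
  rewrite (bigD1 (coordB gm)) //= eqxx big1 ?addr0; last first.
    by move=> l; rewrite -val_eqE /= => /negbTE ->; rewrite mulr0.
  rewrite /inst_theta signs_coordB /= ltnNge leq_addr /= /pm.
  by move: (Num.sqrt _) s0 => r s0; case: (sigma _); field.
rewrite (bigD1 (Ordinal (coordBS_subproof gm))) //= eqxx big1 ?addr0; last first.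
  by move=> l; rewrite -val_eqE /= => /negbTE ->; rewrite mulr0.
rewrite /inst_theta signs_coordBS /= ltnNge (leq_trans (leq_addr _ _) (leqnSn _)) /= /pm.
by move: (Num.sqrt _) s0 => r s0; case: (sigma _) => /=; field.
Qed.

Lemma set_value_A (R : realType) (Rs Bs : R) (k T m' t : nat)
    (sigma : {ffun 'I_(dtot m') -> bool}) (J : {set 'I_(narms k m')}) :
  (t < TA T)%N ->
  set_value (inst_feat Bs k T m') (inst_theta Rs k T m' (signs sigma)) t J =
  \sum_(i in J) \sum_(l < dtot m' | (l < dA m')%N)
     Rs / Num.sqrt (k * TA T)%:R * (pm (sigma l) * featA k m' i l).
Proof.
move=> tA; apply: eq_bigr => i _; rewrite -inner_featA.
by apply: eq_bigr => l _; rewrite /inst_feat tA.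
Qed.

Lemma set_value_B (R : realType) (Rs Bs : R) (k T m' t : nat)
    (sigma : {ffun 'I_(dtot m') -> bool}) (J : {set 'I_(narms k m')})
    (gm : (groupB T m' t < m')%N) :
  (TA T <= t)%N -> J \subset [set i : 'I_(narms k m') | (val i < 2 * k)%N] ->
  set_value (inst_feat Bs k T m') (inst_theta Rs k T m' (signs sigma)) t J =
  \sum_(i in J) Bs * (pm (sigma (coordB gm)) * pm (i < k)%N).
Proof.
move=> tA /fintype.subsetP J2k; apply: eq_bigr => i iJ.
have i2k : (i < 2 * k)%N by have := J2k _ iJ; rewrite inE.
rewrite -(inner_featB Rs Bs sigma gm i2k).
by apply: eq_bigr => l _; rewrite /inst_feat ltnNge tA.
Qed.

Lemma best_armsA (R : realType) (k m' : nat) (sigma : {ffun 'I_(dtot m') -> bool}) :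
  exists2 J : {set 'I_(narms k m')}, #|J| = k &
    forall i (l : 'I_(dtot m')), i \in J -> (l < dA m')%N ->
      featA k m' i l = pm (sigma l) :> R.
Proof.
(* A bit 1 encodes the entry -1, hence the negation. The default is never reached, since [l < dA m']
   is a valid coordinate. *)
have [w wD wb] := bits_exist (dA m')
  (fun l => if insub l is Some i then ~~ sigma i else false).
have lt (s : 'I_k) : (s * 2 ^ dA m' + w < narms k m')%N.
  rewrite /narms; have := ltn_ord s; move: (2 ^ dA m')%N wD => q; nia.
pose arm s := Ordinal (lt s) : 'I_(narms k m').
exists [set arm s | s : 'I_k].
  rewrite card_imset ?card_ord // => s1 s2 /(congr1 val) /= /eqP.
  rewrite eqn_add2r eqn_mul2r expn_eq0 /= => /eqP h; exact: val_inj.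
move=> i l /imsetP[s _ ->] lD; rewrite featA_pm //= modnMDl modn_small //.
by rewrite wb // valK negbK.
Qed.

Lemma best_armsB (k m' : nat) (b : bool) : (0 < m')%N ->
  exists2 J : {set 'I_(narms k m')}, #|J| = k &
    forall i, i \in J -> (i < 2 * k)%N && ((i < k)%N == b).
Proof.
move=> m0; have le2k : (2 * k <= narms k m')%N.
  by rewrite /narms mulnC leq_mul2l -[X in (X <= _)%N]expn1 leq_exp2l ?orbT // /dA; lia.
have lt (s : 'I_k) : (s + (if b then 0 else k) < narms k m')%N.
  by apply: leq_trans le2k; have := ltn_ord s; case: b; lia.
exists [set Ordinal (lt s) | s : 'I_k].
  rewrite card_imset ?card_ord // => s1 s2 /(congr1 val) /= /eqP.
  by rewrite eqn_add2r => /eqP h; exact: val_inj.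
by move=> i /imsetP[s _ ->] /=; move: {lt} (ltn_ord s); case: b; lia.
Qed.

Lemma flip_pm_sum (R : realType) (n : nat) (u : 'I_n) (sigma : {ffun 'I_n -> bool})
    (f : R) : (1 - pm (sigma u) * f) + (1 - pm (flip u sigma u) * f) = 2.
Proof. by rewrite ffunE eqxx addbT; case: (sigma u); rewrite /pm /=; lra. Qed.

Lemma flip_other (n : nat) (u l : 'I_n) (sigma : {ffun 'I_n -> bool}) :
  l != u -> flip u sigma l = sigma l.
Proof. by move=> /negbTE lu; rewrite ffunE lu addbF. Qed.

Lemma inner_inst_A (R : realType) (Bs : R) (k T m' t : nat) theta
    (i : 'I_(narms k m')) : (t < TA T)%N ->
  inner theta (inst_feat Bs k T m' t i) = inner theta (featA k m' i).
Proof. by move=> tA; apply: eq_bigr => l _; rewrite /inst_feat tA. Qed.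

Lemma inner_inst_B (R : realType) (Bs : R) (k T m' t : nat) theta
    (i : 'I_(narms k m')) : (TA T <= t)%N ->
  inner theta (inst_feat Bs k T m' t i) = inner theta (featB Bs k T m' t i).
Proof. by move=> tA; apply: eq_bigr => l _; rewrite /inst_feat ltnNge tA. Qed.

Lemma round_gap_A (R : realType) (Rs Bs : R) (k T m' t : nat)
    (sigma : {ffun 'I_(dtot m') -> bool}) (I : {set 'I_(narms k m')}) :
  (t < TA T)%N -> inst_S k T m' t I ->
  ((\sum_l costA Rs T sigma l t I)%:E <=
   round_gap (inst_feat Bs k T m') (inst_S k T m')
     (inst_theta Rs k T m' (signs sigma)) t I)%E.
Proof.
move=> tA /andP[/eqP Ik _]; have [J Jk Jbest] := best_armsA R k sigma.
have SJ : inst_S k T m' t J by rewrite /inst_S Jk eqxx tA.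
apply: le_trans (round_gap_ge _ _ _ SJ).
rewrite lee_fin !set_value_A //.
set e := Rs / _.
(* Every best arm earns [e] on each coordinate. As [I] also has [k] elements, the optimum can be
   summed over [I] and compared arm by arm. *)
have -> : \sum_(i in J) \sum_(l < dtot m' | (l < dA m')%N)
    e * (pm (sigma l) * featA k m' i l)
  = \sum_(i in I) \sum_(l < dtot m' | (l < dA m')%N) e.
  transitivity (\sum_(i in J) (\sum_(l < dtot m' | (l < dA m')%N) e)); last first.
    by rewrite !sumr_const Ik Jk.
  apply: eq_bigr => i iJ.
  by apply: eq_bigr => l lD; rewrite (Jbest _ _ iJ lD) pm_sqr mulr1.
rewrite -sumrB le_eqVlt; apply/orP; left; apply/eqP.
under [RHS]eq_bigr => i _ do rewrite -sumrB.
rewrite exchange_big /= [RHS]big_mkcond; apply: eq_bigr => l _.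
rewrite /costA tA /=; case: ifP => // _; apply: eq_bigr => i _.
by rewrite mulrBr mulr1.
Qed.

Definition group_coord {T m' : nat} (j : 'I_(minn m' (TB T))) : 'I_(dtot m') :=
  coordB (leq_trans (ltn_ord j) (geq_minl m' (TB T))).

Lemma round_gap_B (R : realType) (Rs Bs : R) (k T m' t : nat)
    (sigma : {ffun 'I_(dtot m') -> bool}) (I : {set 'I_(narms k m')}) :
  (0 < m')%N -> (TA T <= t)%N -> (t < T)%N -> inst_S k T m' t I ->
  ((\sum_j costB Bs T sigma (@group_coord T m' j) t I)%:E <=
   round_gap (inst_feat Bs k T m') (inst_S k T m')
     (inst_theta Rs k T m' (signs sigma)) t I)%E.
Proof.
move=> m0 tA tT SI; have gG := groupB_lt m0 tA tT.
have gm := leq_trans gG (geq_minl _ _).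
have [J Jk Jbest] := @best_armsB k m' (sigma (coordB gm)) m0.
have J2k : J \subset [set i : 'I_(narms k m') | (val i < 2 * k)%N].
  by apply/fintype.subsetP => i /Jbest/andP[]; rewrite inE.
have SJ : inst_S k T m' t J by rewrite /inst_S Jk eqxx J2k orbT.
have /andP[/eqP Ik] := SI; rewrite ltnNge tA /= => I2k.
apply: le_trans (round_gap_ge _ _ _ SJ).
rewrite lee_fin (set_value_B Rs Bs sigma gm tA J2k) (set_value_B Rs Bs sigma gm tA I2k).
have -> : \sum_(i in J) Bs * (pm (sigma (coordB gm)) * pm (i < k)%N)
  = \sum_(i in I) Bs.
  transitivity (\sum_(i in J) Bs); last by rewrite !sumr_const Ik Jk.
  apply: eq_bigr => i iJ.
  by have /andP[_ /eqP ->] := Jbest _ iJ; rewrite pm_sqr mulr1.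
(* Only the group active in round [t] is charged. *)
rewrite -sumrB (bigD1 (Ordinal gG)) //= big1 ?addr0; last first.
  move=> j; rewrite -val_eqE /= => /negbTE jg.
  by rewrite /costB tA /= eqn_add2l eqn_pmul2l // jg.
rewrite /costB tA /= eqxx; apply: ler_sum => i _.
rewrite (_ : group_coord _ = coordB gm); last exact: val_inj.
by rewrite mulrBr mulr1.
Qed.

(** * Lower bound for each coordinate and each group *)

Definition inst_cost {R : realType} (Rs Bs : R) (k T m' : nat)
    (pol : policy R (narms k m'))
    (z : {ffun 'I_(dtot m') -> bool} -> nat -> {set 'I_(narms k m')} -> R)
    (sigma : {ffun 'I_(dtot m') -> bool}) : \bar R :=
  policy_cost (inst_feat Bs k T m') (inst_noisy T) Rs
    (inst_theta Rs k T m' (signs sigma)) pol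
    (fun t I => (z sigma t I)%:E) T 0 [::] [::].

(** The means of each arm differ by [2 * e] in absolute value, so with [M = k * TA T] one observed
    arm has affinity [exp (- 1 / (2 * M))], and a round has [rho = h ^+ k]. The two costs of a round
    add up to [2 * e * k]. *)
Lemma costA_flip (R : realType) (Rs Bs : R) (k T m' : nat)
    (pol : policy R (narms k m')) (sigma : {ffun 'I_(dtot m') -> bool})
    (l : 'I_(dtot m')) :
  0 < Rs -> (0 < k)%N -> valid_policy (inst_S k T m') T pol -> (l < dA m')%N ->
  let V := inst_cost Rs Bs T pol (fun tau => costA Rs T tau l) in
  ((Rs * Num.sqrt (k * TA T)%:R / 4)%:E <= V sigma + V (flip l sigma))%E.
Proof.
move=> Rs0 k0 vp lD /=.
have V0 tau : (0 <= inst_cost Rs Bs T pol (fun tau => costA Rs T tau l) tau)%E.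
  by apply: policy_cost_ge0 vp _ => t I; rewrite lee_fin costA_ge0 // ltW.
(* Without Type A rounds the claimed bound is zero. *)
have [TA0|TA0] := posnP (TA T).
  by rewrite TA0 muln0 sqrtr0 mulr0 mul0r adde_ge0.
pose M : R := (k * TA T)%:R.
have M0 : 0 < M by rewrite ltr0n muln_gt0 k0.
pose e := Rs / Num.sqrt M.
have e0 : 0 < e by rewrite divr_gt0 // sqrtr_gt0.
have e2 : e ^+ 2 = Rs ^+ 2 / M by rewrite /e expr_div_n sqr_sqrtr // ltW.
pose h := expR (- (2 * M)^-1).
have step : ((2 * e * k%:R) * (TA T)%:R / 8 = Rs * Num.sqrt M / 4).
  have -> : Rs * Num.sqrt M = e * (k%:R * (TA T)%:R).
    rewrite -natrM -/M -[in e * M](sqr_sqrtr (ltW M0)) /e; field.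
    by rewrite gt_eqF // sqrtr_gt0.
  by field.
rewrite -step.
apply: (@two_point_policy_cost _ _ _ _ (inst_S k T m') _ _ _ _ _ (TA T) T
  (costA Rs T sigma l) (costA Rs T (flip l sigma) l) (2 * e * k%:R) (h ^+ k)) => //.
- by rewrite gt_eqF.
- by rewrite exprn_ge0 // expR_ge0.
- by rewrite !mulr_ge0 // ltW.
- by move=> t I; rewrite costA_ge0 // ltW.
- by move=> t I; rewrite costA_ge0 // ltW.
- move=> t I tA /andP[/eqP Ik _]; rewrite /costA tA lD /= -big_split /=.
  rewrite le_eqVlt; apply/orP; left; apply/eqP.
  under eq_bigr => i _ do rewrite -mulrDr flip_pm_sum.
  by rewrite sumr_const Ik -mulr_natr -/M -/e; ring.
- move=> t I tA /andP[/eqP Ik _].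
  rewrite -[in RHS]Ik -prodr_const; apply: eq_bigr => i _.
  rewrite !inner_inst_A // !inner_featA -sumrB (bigD1 l) //= big1 ?addr0; last first.
    by move=> l' /andP[_ l'l]; rewrite flip_other // subrr.
  rewrite /h; congr expR; rewrite -mulrBr -mulrBl exprMn -/M -/e e2.
  rewrite ffunE eqxx addbT featA_pm //.
  have -> : ((pm (sigma l) - pm (~~ sigma l)) * pm (~~ odd ((i %% 2 ^ dA m') %/ 2 ^ l)))
      ^+ 2 = 4 :> R.
    by case: (sigma l); case: (odd _); rewrite /pm /=; ring.
  by field; rewrite !pnatr_eq0 -!lt0n TA0 k0 gt_eqF.
- by rewrite /TA; lia.
rewrite -exprM -expRM_natl.
have -> : (k * TA T)%:R * - (2 * M)^-1 = - 2^-1 :> R.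
  by rewrite -/M; field; rewrite !pnatr_eq0 -!lt0n TA0 k0.
(* The total affinity [exp (- 1 / 2)] is at least [1 - 1 / 2]. *)
by apply: le_trans (expR_ge1Dx _); lra.
Qed.

(** The round used is the first of group [j]: earlier feedback involves only Type A coordinates and
    earlier groups, which the flip leaves alone. *)
Lemma costB_flip (R : realType) (Rs Bs : R) (k T m' : nat)
    (pol : policy R (narms k m')) (sigma : {ffun 'I_(dtot m') -> bool})
    (j : 'I_(minn m' (TB T))) :
  0 < Bs -> valid_policy (inst_S k T m') T pol ->
  let V := inst_cost Rs Bs T pol (fun tau => costB Bs T tau (group_coord j)) in
  ((2 * Bs * k%:R)%:E <= V sigma + V (flip (group_coord j) sigma))%E.
Proof.
move=> Bs0 vp /=; have jm := leq_trans (ltn_ord j) (geq_minl m' (TB T)).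
have m0 : (0 < m')%N by exact: leq_trans jm.
have [u [uT uj ulast]] := first_round (ltn_ord j) (geq_minr m' (TB T)).
have t0T : (TA T + u < T)%N.
  by move: uT; rewrite /TB /TA; lia.
apply: (@uninformed_policy_cost _ _ _ _ (inst_S k T m') _ _ _ _ _ T (TA T + u)) => //.
- by rewrite !mulr_ge0 // ltW.
- by move=> t I; rewrite lee_fin costB_ge0 // ltW.
- by move=> t I; rewrite lee_fin costB_ge0 // ltW.
- move=> t I i tt0 /andP[_ SI] iI; have [tA|tA] := ltnP t (TA T).
    rewrite !inner_inst_A // !inner_featA; apply: eq_bigr => l lD.
    rewrite flip_other // -val_eqE /=; apply: contraL lD => /eqP ->.
    by rewrite -leqNgt leq_addr.
  have tT : (t < T)%N by exact: ltn_trans tt0 t0T.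
  have gm := leq_trans (groupB_lt m0 tA tT) (geq_minl _ _).
  have i2k : (i < 2 * k)%N.
    move: SI; rewrite ltnNge tA /= => /fintype.subsetP/(_ _ iI).
    by rewrite inE.
  rewrite !inner_inst_B // !(inner_featB Rs Bs _ gm i2k) flip_other //.
  rewrite -val_eqE /= eqn_add2l eqn_pmul2l // neq_ltn ulast //.
  by rewrite ltn_subLR.
- move=> I /andP[/eqP Ik _]; rewrite -EFinD lee_fin /costB leq_addr /=.
  have -> : groupB T m' (TA T + u) = j by rewrite /groupB addKn.
  rewrite eqxx -big_split /= le_eqVlt; apply/orP; left; apply/eqP.
  under eq_bigr => i _ do rewrite -mulrDr flip_pm_sum.
  by rewrite sumr_const Ik -mulr_natr; ring.
Qed.

(** * From the summed bounds to the rate *)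

(** If there are [m'] groups and [T > 1], the first term of the minimum is reached; otherwise each
    Type B round is its own group and the second is. The constant [1 / 32] is dictated by the Type A
    term. *)
Lemma regret_rate (R : realType) (Rs Bs : R) (k T m' : nat) :
  0 < Rs -> 0 < Bs -> (0 < T)%N -> (0 < m')%N ->
  1 / 32 * Num.min (Rs * (dtot m')%:R * Num.sqrt (k * T)%:R
                     + Bs * (dtot m')%:R * k%:R)
                    (Bs * k%:R * T%:R)
  <= ((dA m')%:R * (Rs * Num.sqrt (k * TA T)%:R / 4)
      + (minn m' (TB T))%:R * (2 * Bs * k%:R)) / 2.
Proof.
move=> Rs0 Bs0 T0 m0.
have Bk0 : 0 <= Bs * k%:R by rewrite mulr_ge0 // ltW.
have sA0 : 0 <= Rs * Num.sqrt (k * TA T)%:R by rewrite mulr_ge0 ?sqrtr_ge0 // ltW.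
have dE : (dtot m')%:R = 4 * m'%:R :> R.
  by rewrite -natrM; congr (_%:R); rewrite /dtot /dA; lia.
have DE : (dA m')%:R = 2 * m'%:R :> R by rewrite -natrM.
have m0R : 0 <= m'%:R :> R by [].
rewrite dE DE; have [/andP[mT T2]|] := boolP ((m' <= TB T)%N && (1 < T)%N).
  rewrite (minn_idPl mT).
  (* From [T >= 2] on, rounding down costs at most a factor: [T <= 4 * TA T]. *)
  have sT : Rs * Num.sqrt (k * T)%:R <= 2 * (Rs * Num.sqrt (k * TA T)%:R).
    rewrite mulrCA ler_pM2l //.
    have -> : 2 = Num.sqrt 4 :> R.
      by rewrite (_ : 4 = 2 ^+ 2) ?sqrtr_sqr ?ger0_norm //; ring.
    rewrite -sqrtrM // ler_wsqrtr // -natrM ler_nat mulnCA leq_mul2l.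
    by apply/orP; right; rewrite /TA; lia.
  apply: (@le_trans _ _ (1 / 32 * (Rs * (4 * m'%:R) * Num.sqrt (k * T)%:R
      + Bs * (4 * m'%:R) * k%:R))).
    by rewrite ler_wpM2l // ge_min lexx.
  have := ler_wpM2l m0R sT; have := mulr_ge0 m0R Bk0; have := mulr_ge0 m0R sA0.
  nra.
(* The case [T = 1] falls here too, with [TB T = 1 <= m']. *)
move=> h; have GT : (minn m' (TB T) = TB T)%N.
  by apply/minn_idPr; move: h; rewrite /TB /TA; lia.
rewrite GT; apply: (@le_trans _ _ (1 / 32 * (Bs * k%:R * T%:R))).
  by rewrite ler_wpM2l // ge_min lexx orbT.
have TT : T%:R <= 2 * (TB T)%:R :> R by rewrite -natrM ler_nat /TB /TA; lia.
have := ler_wpM2l Bk0 TT; have := mulr_ge0 m0R sA0.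
have : 0 <= Bs * k%:R * (TB T)%:R by rewrite mulr_ge0.
nra.
Qed.

Unset Implicit Arguments.

Theorem theorem7 :
  forall R : realType,
  exists c C : R, 0 < c /\ 0 < C /\
  forall (Rs Bs : R) (k T m' : nat),
    0 < Rs -> 0 < Bs -> (0 < k)%N -> (0 < T)%N -> (0 < m')%N ->
    C * (Rs * (dtot m')%:R / Bs) ^+ 2 <= (k * T)%:R ->
    forall pol : policy R (narms k m'),
    valid_policy (inst_S k T m') T pol ->
    exists sgn : 'I_(dtot m') -> bool,
      ((c * Num.min (Rs * (dtot m')%:R * Num.sqrt (k * T)%:R
                     + Bs * (dtot m')%:R * k%:R)
                    (Bs * k%:R * T%:R))%:E
       <= expected_regret (inst_feat Bs k T m') (inst_S k T m') (inst_noisy T)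
            Rs (inst_theta Rs k T m' sgn) pol T)%E.
Proof.
move=> R; exists (1 / 32), 1; split; first lra; split; first lra.
move=> Rs Bs k T m' Rs0 Bs0 k0 T0 m0 _ pol vp.
pose G := minn m' (TB T).
pose cost (j : 'I_(dtot m') + 'I_G) sigma t (I : {set 'I_(narms k m')}) : R :=
  match j with
  | inl l => costA Rs T sigma l t I
  | inr j => costB Bs T sigma (group_coord j) t I
  end.
have cost0 j sigma t I : (0 <= (cost j sigma t I)%:E)%E.
  by rewrite lee_fin; case: j => j; rewrite ?costA_ge0 ?costB_ge0 // ltW.
pose V j := inst_cost Rs Bs T pol (cost j).
have V0 j sigma : (0 <= V j sigma)%E by exact: policy_cost_ge0 vp (cost0 j sigma).
pose u (j : 'I_(dtot m') + 'I_G) : 'I_(dtot m') :=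
  match j with inl l => l | inr j => group_coord j end.
(* The left summand ranges over all coordinates; on the Type B block [costA] vanishes and the bound
   is 0. *)
pose b (j : 'I_(dtot m') + 'I_G) : R :=
  match j with
  | inl l => if (l < dA m')%N then Rs * Num.sqrt (k * TA T)%:R / 4 else 0
  | inr _ => 2 * Bs * k%:R
  end.
have Vb j sigma : ((b j)%:E <= V j sigma + V j (flip (u j) sigma))%E.
  case: j => [l|j]; last exact: (costB_flip Rs sigma j Bs0 vp).
  rewrite /b; case: ifP => lD; last by rewrite adde_ge0.
  exact: (costA_flip Bs sigma Rs0 k0 vp lD).
have [sigma Hs] := exists_sum_ge_flip V0 Vb; exists (signs sigma).
(* An infeasible set could have a negative gap. Replacing its gap by 0 leaves the expectation
   unchanged and makes the cost nonnegative, as monotonicity requires. *)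
have -> : expected_regret (inst_feat Bs k T m') (inst_S k T m') (inst_noisy T)
    Rs (inst_theta Rs k T m' (signs sigma)) pol T
  = policy_cost (inst_feat Bs k T m') (inst_noisy T) Rs
      (inst_theta Rs k T m' (signs sigma)) pol
      (fun t I => if inst_S k T m' t I then round_gap (inst_feat Bs k T m')
         (inst_S k T m') (inst_theta Rs k T m' (signs sigma)) t I else 0%E)
      T 0 [::] [::].
  rewrite /expected_regret exp_regret_fromE.
  by apply: eq_policy_cost vp _ _ => // t I _ ->.
apply: (@le_trans _ _ (policy_cost (inst_feat Bs k T m') (inst_noisy T) Rs
      (inst_theta Rs k T m' (signs sigma)) pol
      (fun t I => \sum_j (cost j sigma t I)%:E)%E T 0 [::] [::])); last first.
  apply: le_policy_cost vp _ _ _ _ => //.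
  - by move=> t I; exact: sume_ge0.
  - move=> t I; case: ifP => // SI.
    by apply: le_trans (round_gap_ge _ _ _ SI); rewrite subrr.
  move=> t I tT SI; rewrite SI sumEFin big_sumType /=.
  (* In each round only the costs of the active phase are nonzero. *)
  have [tA|tA] := ltnP t (TA T).
    rewrite [X in _ + X]big1 ?addr0; first exact: round_gap_A.
    by move=> j _; rewrite /costB leqNgt tA.
  rewrite [X in X + _]big1 ?add0r; first exact: round_gap_B.
  by move=> l _; rewrite /costA ltnNge tA.
rewrite (@policy_cost_sum _ _ _ _ _ _ _ _ _ _ _ _ _ _ _ _ _ vp) //; apply: le_trans Hs.
rewrite lee_fin big_sumType /= sumr_const card_ord -[_ *+ G]mulr_natl.
apply: le_trans (regret_rate _ Rs0 Bs0 T0 m0) _.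
rewrite le_eqVlt; apply/orP; left; apply/eqP; congr ((_ + _) / _).
have Dd : (dA m' <= dtot m')%N by rewrite /dtot leq_pmull.
rewrite -big_mkcond (big_ord_narrow Dd) sumr_const card_ord.
by rewrite -[RHS]mulr_natl.
Qed.
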